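(* $\mathsf{AUC}_{[0,1]}<_W\mathsf{PCC}_{[0,1]}$.
   Context: A represented space is a pair $(X,\delta_X)$ with $\delta_X:\subseteq\mathbb{N}^\mathbb{N}\to X$ a partial surjection; $[0,1]$ carries its Cauchy representation. A realizer of $f:\subseteq X\rightrightarrows Y$ is a partial $F$ with $\delta_Y F(p)\in f(\delta_X(p))$ for all $p\in\mathrm{dom}(f\circ\delta_X)$. $f\le_W g$ if there are computable partial $H,K:\subseteq\mathbb{N}^\mathbb{N}\to\mathbb{N}^\mathbb{N}$ such that $p\mapsto H\langle p,GK(p)\rangle$ realizes $f$ for every realizer $G$ of $g$; $f<_W g$ means $f\le_W g$ and not $g\le_W f$. $\mathcal{A}_-([0,1])$ denotes the closed subsets of $[0,1]$ represented by negative information (a name of $A$ enumerates rational open intervals whose union is $[0,1]\setminus A$). $\mathsf C_{[0,1]}:\subseteq\mathcal A_-([0,1])\rightrightarrows[0,1]$, $A\mapsto A$, is defined on nonempty $A$. All-or-unique choice $\mathsf{AUC}_{[0,1]}$ is $\mathsf C_{[0,1]}$ restricted to the sets $[0,1]$ and $\{x\}$, $x\in[0,1]$. $\mathsf{PCC}_{[0,1]}$ is $\mathsf C_{[0,1]}$ restricted to intervals $[a,b]$ with $0\le a<b\le1$ (closed connected sets of positive measure). *)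

(* Defs.v *)
From Stdlib Require Import Reals Lra Lia Arith List Cantor.
Import ListNotations.
Open Scope R_scope.

Definition name := nat -> nat.

Definition pairing (p q : name) : name :=
  fun n => if Nat.even n then p (Nat.div2 n) else q (Nat.div2 n).

Inductive code : Type :=
| CZero : code
| CSucc : code
| CProj : nat -> code
| COracle : code
| CComp : code -> list code -> code
| CPrimRec : code -> code -> code
| CMu : code -> code.

Inductive eval (p : name) : code -> list nat -> nat -> Prop :=
| eZero xs : eval p CZero xs 0
| eSucc xs : eval p CSucc xs (S (hd 0%nat xs))
| eProj i xs : eval p (CProj i) xs (nth i xs 0%nat)
| eOracle xs : eval p COracle xs (p (hd 0%nat xs))
| eComp f gs xs ys y :
    Forall2 (fun g y => eval p g xs y) gs ys -> eval p f ys y ->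
    eval p (CComp f gs) xs y
| ePR0 f g xs y : eval p f xs y -> eval p (CPrimRec f g) (0%nat :: xs) y
| ePRS f g n xs r y :
    eval p (CPrimRec f g) (n :: xs) r -> eval p g (n :: r :: xs) y ->
    eval p (CPrimRec f g) (S n :: xs) y
| eMu f xs n :
    eval p f (n :: xs) 0%nat ->
    (forall m, (m < n)%nat -> exists k, eval p f (m :: xs) (S k)) ->
    eval p (CMu f) xs n.

Definition comp_fun (e : code) (p q : name) : Prop :=
  forall n, eval p e [n] (q n).

(** Represented spaces: a (partial, single-valued) naming relation
    delta p x  <->  p is a name of x. *)
Definition rep (X : Type) := name -> X -> Prop.

(** Multi-valued partial problems f :⊆ X ⇉ Y, given as relations;
    dom f = { x | f x is nonempty }. *)
Definition mvf (X Y : Type) := X -> Y -> Prop.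

Definition realizes {X Y} (dX : rep X) (dY : rep Y) (f : mvf X Y)
  (G : name -> option name) : Prop :=
  forall p x, dX p x -> (exists y, f x y) ->
    exists q y, G p = Some q /\ dY q y /\ f x y.

Definition W_le {X Y Z W} (dX : rep X) (dY : rep Y) (f : mvf X Y)
  (dZ : rep Z) (dW : rep W) (g : mvf Z W) : Prop :=
  exists eH eK : code,
    forall G, realizes dZ dW g G ->
      forall p x, dX p x -> (exists y, f x y) ->
        exists k r o y,
          comp_fun eK p k /\ G k = Some r /\
          comp_fun eH (pairing p r) o /\ dY o y /\ f x y.

Definition W_lt {X Y Z W} (dX : rep X) (dY : rep Y) (f : mvf X Y)
  (dZ : rep Z) (dW : rep W) (g : mvf Z W) : Prop :=
  W_le dX dY f dZ dW g /\ ~ W_le dZ dW g dX dY f.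

Definition nu (n : nat) : R :=
  let '(a, bc) := Cantor.of_nat n in
  let '(b, c) := Cantor.of_nat bc in
  (INR a - INR b) / INR (S c).

Definition in01 (x : R) : Prop := 0 <= x <= 1.

Definition delta_C (p : name) (x : R) : Prop :=
  in01 x /\ forall n, Rabs (nu (p n) - x) <= / 2 ^ n.

(** Negative-information representation of closed subsets of [0,1]
    (sets as predicates).  p n = 0 : no interval; p n = k+1 with
    k = <a,b> : rational open interval (nu a, nu b).  p names A iff A ⊆ [0,1]
    and [0,1] \ A is the union of the listed intervals (within [0,1]). *)
Definition interval_of (k : nat) (x : R) : Prop :=
  let '(a, b) := Cantor.of_nat k in nu a < x < nu b.

Definition delta_A (p : name) (A : R -> Prop) : Prop :=
  (forall x, A x -> in01 x) /\
  (forall x, in01 x -> (~ A x <-> exists n k, p n = S k /\ interval_of k x)).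

Definition C01 : mvf (R -> Prop) R := fun A y => A y.

Definition AUC01 : mvf (R -> Prop) R := fun A y =>
  ((forall z, A z <-> in01 z) \/
   (exists x, in01 x /\ forall z, A z <-> z = x)) /\ A y.

Definition PCC01 : mvf (R -> Prop) R := fun A y =>
  (exists a b, 0 <= a < b /\ b <= 1 /\ forall z, A z <-> a <= z <= b) /\ A y.

(* Main.v *)
(* [AUC <= PCC]: as long as the input has removed nothing from [0,1], the forward functional
   removes nothing and the backward functional copies its answer.  Once something has been
   removed, at stage [s] say, the input is a singleton [{x}], and [x] can be computed by
   exhausting its complement; the forward functional then restricts to a nondegenerate segment
   within [2^-s] of [x], so that the digits copied before stage [s] are correct for [x] too,
   and the backward functional computes all later digits directly.

   [PCC </= AUC]: on segments the forward functional yields either always [0,1], and then one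
   fixed answer serves all inputs, or for some input a singleton [{x}].  A finite part of that
   input already confines the forward output to a small ball around [x], hence to singletons
   having a name that shares a long prefix with a given name of [x].  Either way the answer can
   be kept unchanged far enough to fix a digit of the result, after which the input segment can
   still be shrunk away from it. *)
Require Import Defs.
From Stdlib Require Import Reals Lra Lia List Cantor FunctionalExtensionality ClassicalEpsilon.
From Coquelicot Require Import Rcomplements Compactness.
Import ListNotations.

(** * Determinacy and finite use of oracle computations *)
Local Open Scope nat_scope.

(** The induction hypotheses also reach the derivations nested inside [Forall2] in a composition and
    under the existential in [eMu]. The recursion is on the derivation itself, with an inner
    induction along the [Forall2]. *)
Fixpoint eval_nested_ind (p : name) (P : code -> list nat -> nat -> Prop)
  (H0 : forall xs, P CZero xs 0)
  (HS : forall xs, P CSucc xs (S (hd 0 xs)))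
  (HP : forall i xs, P (CProj i) xs (nth i xs 0))
  (HO : forall xs, P COracle xs (p (hd 0 xs)))
  (HC : forall f gs xs ys y,
      Forall2 (fun g z => eval p g xs z /\ P g xs z) gs ys ->
      eval p f ys y -> P f ys y -> P (CComp f gs) xs y)
  (HR0 : forall f g xs y, eval p f xs y -> P f xs y -> P (CPrimRec f g) (0 :: xs) y)
  (HRS : forall f g n xs r y,
      eval p (CPrimRec f g) (n :: xs) r -> P (CPrimRec f g) (n :: xs) r ->
      eval p g (n :: r :: xs) y -> P g (n :: r :: xs) y ->
      P (CPrimRec f g) (S n :: xs) y)
  (HM : forall f xs n,
      eval p f (n :: xs) 0 -> P f (n :: xs) 0 ->
      (forall m, m < n -> exists k, eval p f (m :: xs) (S k) /\ P f (m :: xs) (S k)) ->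
      P (CMu f) xs n)
  (e : code) (xs : list nat) (y : nat) (h : eval p e xs y) {struct h} : P e xs y.
Proof.
  pose (rec := eval_nested_ind p P H0 HS HP HO HC HR0 HRS HM).
  destruct h as [ | | | | f gs xs ys y hgs hf | f g xs y hf | f g n xs r y hr hg
                | f xs n hz hlt].
  - apply H0.
  - apply HS.
  - apply HP.
  - apply HO.
  - apply (HC f gs xs ys y).
    + clear hf. induction hgs as [|g z gs' ys' hg hgs' IH]; constructor.
      * split; [exact hg | exact (rec _ _ _ hg)].
      * exact IH.
    + exact hf.
    + exact (rec _ _ _ hf).
  - exact (HR0 f g xs y hf (rec _ _ _ hf)).
  - exact (HRS f g n xs r y hr (rec _ _ _ hr) hg (rec _ _ _ hg)).
  - apply (HM f xs n hz (rec _ _ _ hz)).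
    intros m hm. destruct (hlt m hm) as [k hk].
    exists k. split; [exact hk | exact (rec _ _ _ hk)].
Qed.

Lemma eval_functional (p : name) (e : code) (xs : list nat) (y : nat) :
  eval p e xs y -> forall y', eval p e xs y' -> y = y'.
Proof.
  intros h.
  induction h as [ | | | | f gs xs ys y Hgs Hf IHf | f g xs y Hf IHf
                 | f g n xs r y Hr IHr Hg IHg | f xs n Hz IHz Hlt]
    using eval_nested_ind; intros y' h'; inversion h'; subst; auto.
  - apply IHf.
    match goal with [ Hys : Forall2 _ gs ?zs |- _ ] => assert (ys = zs) as ->; [|assumption];
      clear - Hgs Hys; revert zs Hys end.
    induction Hgs as [|g z gs ys [_ Hz] _ IH]; intros zs Hzs; inversion Hzs; subst; f_equal; auto.
  - match goal with [ Hr' : eval p _ (n :: xs) ?r' |- _ ] => apply IHr in Hr'; subst r' end.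
    auto.
  - match goal with [ Hz' : eval p f (?m :: xs) 0, Hlt' : forall m, _ < _ -> _ |- _ ] =>
      rename m into n' end.
    (* Of two distinct minima, the smaller would be a zero of [f] by one derivation and have a
       successor value by the other. *)
    destruct (Nat.lt_trichotomy n n') as [Hn | [Hn | Hn]]; [|exact Hn|].
    + match goal with [ Hlt' : forall m, m < n' -> exists k, eval _ _ _ _ |- _ ] =>
        destruct (Hlt' n Hn) as [k Hk] end.
      apply IHz in Hk. discriminate.
    + destruct (Hlt n' Hn) as [k [_ Hk]].
      match goal with [ Hz' : eval p f (n' :: xs) 0 |- _ ] => apply Hk in Hz'; discriminate end.
Qed.

Definition agree (L : nat) (p q : name) : Prop := forall n, n < L -> p n = q n.

(** A derivation is finite, so it queries the oracle at finitely many positions only. This is the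
    continuity on which the separation rests. *)
Lemma eval_use (p : name) (e : code) (xs : list nat) (y : nat) :
  eval p e xs y -> exists L, forall q, agree L p q -> eval q e xs y.
Proof.
  assert (mono : forall L L' q, L <= L' -> agree L' p q -> agree L p q).
  { intros L L' q HL Hq n Hn. apply Hq. lia. }
  intros h. induction h using eval_nested_ind.
  - exists 0. intros. constructor.
  - exists 0. intros. constructor.
  - exists 0. intros. constructor.
  - exists (S (hd 0 xs)). intros q Hq. rewrite (Hq (hd 0 xs)) by lia. constructor.
  - destruct IHh as [L HL].
    assert (exists L', forall q, agree L' p q -> Forall2 (fun g z => eval q g xs z) gs ys)
      as [L' HL'].
    { clear - H mono. induction H as [|g z gs ys [_ [L1 H1]] _ [L2 H2]].
      - exists 0. constructor.
      - exists (Nat.max L1 L2). intros q Hq. constructor.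
        + apply H1. apply (mono _ (Nat.max L1 L2)); [lia | exact Hq].
        + apply H2. apply (mono _ (Nat.max L1 L2)); [lia | exact Hq]. }
    exists (Nat.max L L'). intros q Hq. apply eComp with ys.
    + apply HL'. apply (mono _ (Nat.max L L')); [lia | exact Hq].
    + apply HL. apply (mono _ (Nat.max L L')); [lia | exact Hq].
  - destruct IHh as [L HL]. exists L. intros q Hq. constructor. auto.
  - destruct IHh1 as [L1 H1], IHh2 as [L2 H2]. exists (Nat.max L1 L2). intros q Hq.
    apply ePRS with r.
    + apply H1. apply (mono _ (Nat.max L1 L2)); [lia | exact Hq].
    + apply H2. apply (mono _ (Nat.max L1 L2)); [lia | exact Hq].
  - destruct IHh as [L1 H1].
    (* The values below the minimum come from finitely many derivations; their bounds are merged one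
       at a time. *)
    assert (forall b, b <= n -> exists L, forall q, agree L p q ->
              forall m, m < b -> exists k, eval q f (m :: xs) (S k)) as Hb.
    { induction b as [|b IHb]; intros Hb.
      - exists 0. intros q _ m Hm. lia.
      - destruct IHb as [L2 H2]; [lia|].
        destruct (H b) as [k [_ [L3 H3]]]; [lia|].
        exists (Nat.max L2 L3). intros q Hq m Hm.
        destruct (Nat.eq_dec m b) as [->|Hmb].
        + exists k. apply H3. apply (mono _ (Nat.max L2 L3)); [lia | exact Hq].
        + apply (H2 q); [|lia]. apply (mono _ (Nat.max L2 L3)); [lia | exact Hq]. }
    destruct (Hb n (le_n n)) as [L2 H2].
    exists (Nat.max L1 L2). intros q Hq. constructor.
    + apply H1. apply (mono _ (Nat.max L1 L2)); [lia | exact Hq].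
    + apply H2. apply (mono _ (Nat.max L1 L2)); [lia | exact Hq].
Qed.

(** * PCC is not reducible to AUC *)
Local Open Scope R_scope.

Lemma functional_choice {A B : Type} (R : A -> B -> Prop) :
  (forall x, exists y, R x y) -> exists f : A -> B, forall x, R x (f x).
Proof.
  intros H. exists (fun x => proj1_sig (constructive_indefinite_description _ (H x))).
  intros x. apply proj2_sig.
Qed.

(** * Rational approximation and compactness of the unit interval *)

Lemma nu_to_nat (a b c : nat) :
  nu (Cantor.to_nat (a, Cantor.to_nat (b, c))) = (INR a - INR b) / INR (S c).
Proof. unfold nu. now rewrite !Cantor.cancel_of_to. Qed.

Lemma interval_of_to_nat (a b : nat) (x : R) :
  interval_of (Cantor.to_nat (a, b)) x <-> nu a < x < nu b.
Proof. unfold interval_of. now rewrite Cantor.cancel_of_to. Qed.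

Lemma inv_INR_S_small (e : R) : 0 < e -> exists n, / INR (S n) < e.
Proof.
  intros He. destruct (archimed_cor1 e He) as [[|n] [Hn Hpos]]; [lia|]. now exists n.
Qed.

Lemma inv_pow2_small (e : R) : 0 < e -> exists n, / 2 ^ n < e.
Proof.
  intros He.
  destruct (pow_lt_1_zero (/ 2) ltac:(rewrite Rabs_pos_eq; lra) e He) as [n Hn].
  exists n. specialize (Hn n (le_n n)). rewrite <- pow_inv.
  now apply Rle_lt_trans with (1 := Rle_abs _).
Qed.

Lemma inv_pow2_pos (n : nat) : 0 < / 2 ^ n.
Proof. apply Rinv_0_lt_compat, pow_lt. lra. Qed.

Lemma inv_pow2_S (n : nat) : / 2 ^ S n = / 2 ^ n / 2.
Proof. simpl. field. apply pow_nonzero. lra. Qed.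

Lemma inv_pow2_le (m n : nat) : (m <= n)%nat -> / 2 ^ n <= / 2 ^ m.
Proof.
  intros H. apply Rinv_le_contravar; [apply pow_lt; lra | apply Rle_pow; [lra | exact H]].
Qed.

Lemma nu_dense (x y : R) : x < y -> exists n, x < nu n < y.
Proof.
  intros Hxy. destruct (inv_INR_S_small (y - x)) as [c Hc]; [lra|].
  assert (Hp : 0 < INR (S c)) by (apply lt_0_INR; lia).
  destruct (archimed (x * INR (S c))) as [H1 H2].
  set (z := up (x * INR (S c))) in *.
  (* [nu] writes a numerator as a difference of naturals; here these are the positive and the
     negative part of the integer [z]. *)
  exists (Cantor.to_nat (Z.to_nat z, Cantor.to_nat (Z.to_nat (- z), c))).
  rewrite nu_to_nat.
  assert (INR (Z.to_nat z) - INR (Z.to_nat (- z)) = IZR z) as ->.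
  { rewrite !INR_IZR_INZ, <- minus_IZR. f_equal. lia. }
  assert (Hi : INR (S c) * / INR (S c) = 1) by (field; lra).
  split; [apply Rmult_lt_reg_r with (INR (S c)) | apply Rmult_lt_reg_r with (INR (S c))];
    try exact Hp; unfold Rdiv; rewrite ?Rmult_assoc, (Rmult_comm (/ _)), Hi; nra.
Qed.

(** A Lebesgue number together with a bound on the indices. With [U] read off a name, the bound says
    that a finite part of the name suffices for the whole cover. *)
Lemma lebesgue_number_01 (U : nat -> R -> Prop) :
  (forall z, in01 z -> exists n d, 0 < d /\ forall w, Rabs (w - z) < d -> U n w) ->
  exists N d, 0 < d /\
    forall z, in01 z -> exists n, (n < N)%nat /\ forall w, Rabs (w - z) < d -> U n w.
Proof.
  intros Hcov.
  assert (Hc : forall z, exists nd : nat * posreal,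
             in01 z -> forall w, Rabs (w - z) < snd nd -> U (fst nd) w).
  { intros z. destruct (classic (in01 z)) as [Hz | Hz].
    - destruct (Hcov z Hz) as [n [d [Hd H]]]. now exists (n, mkposreal d Hd).
    - now exists (0%nat, mkposreal 1 Rlt_0_1). }
  apply functional_choice in Hc. destruct Hc as [nd Hnd].
  (* The gauge also bounds the index, so that one number controls radius and index. *)
  assert (Hg : forall t, 0 < Rmin (snd (nd t) / 2) (/ INR (S (fst (nd t))))).
  { intros t. apply Rmin_pos.
    - pose proof (cond_pos (snd (nd t))). lra.
    - apply Rinv_0_lt_compat, lt_0_INR. lia. }
  destruct (compactness_value_1d 0 1 (fun t => mkposreal _ (Hg t))) as [d Hd].
  destruct (inv_INR_S_small d (cond_pos d)) as [N HN].
  exists (S N), d. split; [apply cond_pos|]. intros z Hz.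
  (* The compactness lemma provides its tag [t] only under a double negation. *)
  destruct (NNPP _ (Hd z Hz)) as [t [Ht [Hzt Hdt]]]. cbn [pos] in Hzt, Hdt.
  exists (fst (nd t)). split.
  - apply Nat.lt_trans with (S (fst (nd t))); [lia|]. apply INR_lt.
    apply Rnot_le_lt. intros Hle.
    apply Rinv_le_contravar in Hle; [|apply lt_0_INR; lia].
    pose proof (Rmin_r (snd (nd t) / 2) (/ INR (S (fst (nd t))))). lra.
  - intros w Hw. apply (Hnd t Ht).
    pose proof (Rmin_l (snd (nd t) / 2) (/ INR (S (fst (nd t))))).
    replace (w - t) with ((w - z) + (z - t)) by ring.
    apply Rle_lt_trans with (1 := Rabs_triang _ _). lra.
Qed.

Lemma interval_of_open (k : nat) (z : R) :
  interval_of k z -> exists d, 0 < d /\ forall w, Rabs (w - z) < d -> interval_of k w.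
Proof.
  unfold interval_of. destruct (Cantor.of_nat k) as [a b]. intros Hz.
  exists (Rmin (z - nu a) (nu b - z)). split; [apply Rmin_pos; lra|].
  intros w Hw. apply Rabs_def2 in Hw.
  pose proof (Rmin_l (z - nu a) (nu b - z)). pose proof (Rmin_r (z - nu a) (nu b - z)). lra.
Qed.

(** * Negative names and admissible answers *)

Definition removes (p : name) (n : nat) (z : R) : Prop :=
  exists k, p n = S k /\ interval_of k z.

Lemma delta_A_removes (p : name) (A : R -> Prop) (z : R) :
  delta_A p A -> in01 z -> (~ A z <-> exists n, removes p n z).
Proof. intros [_ H] Hz. exact (H z Hz). Qed.

(** The ball around [x] and the intervals listed by [p] cover [[0,1]]; the ball gets index 0 and the
    intervals are shifted by one. Hence finitely many entries of [p] already confine the set to the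
    ball. *)
Lemma delta_A_singleton_lebesgue (p : name) (A : R -> Prop) (x e : R) :
  delta_A p A -> (forall z, A z <-> z = x) -> 0 < e ->
  exists N d, 0 < d /\ forall z, in01 z ->
    (forall w, Rabs (w - z) < d -> Rabs (w - x) < e) \/
    exists n, (n < N)%nat /\ forall w, Rabs (w - z) < d -> removes p n w.
Proof.
  intros Hp HA He.
  destruct (lebesgue_number_01
    (fun n w => match n with 0%nat => Rabs (w - x) < e | S n => removes p n w end))
    as [N [d [Hd H]]].
  - intros z Hz. destruct (Req_dec z x) as [-> | Hzx].
    + exists 0%nat, e. auto.
    + destruct (proj1 (delta_A_removes p A z Hp Hz)) as [n [k [Hk Hi]]].
      { now rewrite HA. }
      destruct (interval_of_open k z Hi) as [d [Hd Hw]].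
      exists (S n), d. split; [exact Hd|]. intros w Hwz. exists k. auto.
  - exists N, d. split; [exact Hd|]. intros z Hz.
    destruct (H z Hz) as [[|n] [Hn Hw]]; [now left | right].
    exists n. split; [lia | exact Hw].
Qed.

Lemma delta_A_functional (p : name) (A B : R -> Prop) (z : R) :
  delta_A p A -> delta_A p B -> (A z <-> B z).
Proof.
  intros HA HB. pose proof (proj1 HA z). pose proof (proj1 HB z).
  destruct (classic (in01 z)) as [Hz | Hz]; [|tauto].
  pose proof (delta_A_removes p A z HA Hz). pose proof (delta_A_removes p B z HB Hz).
  destruct (classic (A z)), (classic (B z)); tauto.
Qed.

Lemma delta_A_empty_name : delta_A (fun _ => 0%nat) in01.
Proof.
  split; [auto|]. intros x Hx. split; [tauto|].
  intros [n [k [Hk _]]]. discriminate.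
Qed.

(* One bit more precise than [delta_C] demands: a finite part of such a name is also the
   beginning of a name of every sufficiently close point. *)
Lemma sharp_name (x : R) : exists q : name, forall n, Rabs (nu (q n) - x) <= / 2 ^ S n.
Proof.
  apply (functional_choice (fun n v => Rabs (nu v - x) <= / 2 ^ S n)). intros n.
  pose proof (inv_pow2_pos (S n)).
  destruct (nu_dense (x - / 2 ^ S n) (x + / 2 ^ S n)) as [v Hv]; [lra|].
  exists v. apply Rabs_le. lra.
Qed.

(** Admissibility of a single answer, without reference to a realizer, so that answers can be varied
    query by query. *)
Definition AUC_answer (k r : name) : Prop :=
  exists B y, delta_A k B /\ AUC01 B y /\ delta_C r y.

(** The realizer follows the selector [s] on the domain and is undefined elsewhere; a value [Some r]
    therefore certifies that the query was a legal instance. *)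
Lemma AUC_realizer (s : name -> name) :
  (forall k, (exists r, AUC_answer k r) -> AUC_answer k (s k)) ->
  exists G, realizes delta_A delta_C AUC01 G /\
    forall k r, G k = Some r -> AUC_answer k r /\ r = s k.
Proof.
  intros Hs.
  exists (fun k => if excluded_middle_informative (exists r, AUC_answer k r)
           then Some (s k) else None).
  split.
  - intros k B Hk [y Hy].
    assert (Hex : exists r, AUC_answer k r).
    { destruct (sharp_name y) as [q Hq].
      exists q, B, y. split; [exact Hk|]. split; [exact Hy|]. split.
      - apply (proj1 Hk), Hy.
      - intros n. apply Rle_trans with (1 := Hq n). apply inv_pow2_le. lia. }
    destruct (excluded_middle_informative _) as [_ | Hn]; [|contradiction].
    destruct (Hs k Hex) as [B' [y' [Hk' [Hy' Hq]]]].
    exists (s k), y'. split; [reflexivity|]. split; [exact Hq|].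
    assert (HB : forall z, B' z <-> B z) by (intros z; exact (delta_A_functional k B' B z Hk' Hk)).
    destruct Hy' as [Hc Hy']. split; [|now apply HB].
    destruct Hc as [Hc | [x [Hx Hc]]]; [left | right; exists x; split; [exact Hx|]];
      intros z; rewrite <- HB; apply Hc.
  - intros k r. destruct (excluded_middle_informative _) as [He | _]; [|discriminate].
    injection 1 as <-. auto.
Qed.

(** * The continuity argument against a reduction *)

Definition segment (a b z : R) : Prop := a <= z <= b.

(** A reduction works with every realizer, and a realizer may be altered at one query at will. So
    the backward functional has to cope with every admissible answer, and realizers disappear from
    the rest of the argument. *)
Lemma W_le_PCC_AUC_spec (eH eK : code)
  (Hred : forall G, realizes delta_A delta_C AUC01 G ->
      forall p x, delta_A p x -> (exists y, PCC01 x y) ->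
        exists k r o y,
          comp_fun eK p k /\ G k = Some r /\
          comp_fun eH (pairing p r) o /\ delta_C o y /\ PCC01 x y)
  (p : name) (a b : R) :
  delta_A p (segment a b) -> 0 <= a < b -> b <= 1 ->
  exists k, comp_fun eK p k /\ (exists r, AUC_answer k r) /\
    forall r, AUC_answer k r ->
      exists o y, comp_fun eH (pairing p r) o /\ delta_C o y /\ segment a b y.
Proof.
  intros Hp Hab Hb.
  assert (Hdom : exists y, PCC01 (segment a b) y).
  { exists a. split; [|unfold segment; lra]. exists a, b. unfold segment. intuition. }
  set (s := fun k => epsilon (inhabits (fun _ : nat => 0%nat)) (AUC_answer k)).
  assert (Hs : forall k, (exists r, AUC_answer k r) -> AUC_answer k (s k)).
  { intros k Hk. apply epsilon_spec, Hk. }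
  destruct (AUC_realizer s Hs) as [G [HG HGs]].
  destruct (Hred G HG p _ Hp Hdom) as [k [r [_ [_ [Hk [HGk _]]]]]].
  exists k. split; [exact Hk|]. split; [exists r; apply (HGs k r HGk)|].
  intros r' Hr'.
  set (s' := fun k' => if excluded_middle_informative (k' = k) then r' else s k').
  destruct (AUC_realizer s') as [G' [HG' HGs']].
  { intros k'. unfold s'. destruct (excluded_middle_informative _) as [-> |]; auto. }
  destruct (Hred G' HG' p _ Hp Hdom) as [k' [r'' [o [y [Hk' [HGk' [Ho [Hy [_ Hyab]]]]]]]]].
  (* The query is computed from [p] alone, so the altered realizer is asked the same question. *)
  assert (k' = k) as ->.
  { apply functional_extensionality. intros n. exact (eval_functional _ _ _ _ (Hk' n) _ (Hk n)). }
  apply HGs' in HGk'. destruct HGk' as [_ Hr].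
  unfold s' in Hr. destruct (excluded_middle_informative _) as [_ | Hn]; [|now destruct Hn].
  subst r''. now exists o, y.
Qed.

Lemma delta_A_restrict (p : name) (A : R -> Prop) (L c : nat) :
  delta_A p A ->
  exists p', agree L p p' /\ delta_A p' (fun z => A z /\ ~ interval_of c z).
Proof.
  intros Hp.
  (* The first [L] entries of [p], then the new interval, then [p] once more from its beginning. *)
  exists (fun n => if (n <? L)%nat then p n else if (n =? L)%nat then S c else p (n - L - 1)%nat).
  split.
  { intros n Hn. apply Nat.ltb_lt in Hn. now rewrite Hn. }
  split; [intros z [Hz _]; now apply (proj1 Hp)|].
  intros z Hz. pose proof (delta_A_removes p A z Hp Hz) as H. split.
  - intros Hn. destruct (classic (interval_of c z)) as [Hc | Hc].
    + exists L, c. rewrite Nat.ltb_irrefl, Nat.eqb_refl. auto.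
    + destruct (proj1 H) as [n [k [Hk Hi]]]; [tauto|].
      exists (L + 1 + n)%nat, k. split; [|exact Hi].
      destruct (Nat.ltb_spec (L + 1 + n) L); [lia|].
      destruct (Nat.eqb_spec (L + 1 + n) L); [lia|].
      rewrite <- Hk. f_equal. lia.
  - intros [n [k [Hk Hi]]] [HAz Hc].
    destruct (n <? L)%nat; [|destruct (n =? L)%nat].
    + apply (proj2 H); [|exact HAz]. now exists n, k.
    + injection Hk as ->. contradiction.
    + apply (proj2 H); [|exact HAz]. exists (n - L - 1)%nat, k. auto.
Qed.

Lemma delta_A_ext (p : name) (A B : R -> Prop) :
  (forall z, A z <-> B z) -> delta_A p A -> delta_A p B.
Proof.
  intros H [H1 H2]. split.
  - intros z Hz. apply H1, H, Hz.
  - intros z Hz. rewrite <- (H2 z Hz), (H z). tauto.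
Qed.

(** One further interval removes all but a piece shorter than a quarter of the segment, at the end
    away from [v]; it can be listed after any finite part of the name. *)
Lemma subsegment_away (p : name) (a b v : R) (L : nat) :
  delta_A p (segment a b) -> 0 <= a < b -> b <= 1 ->
  exists p' a' b', agree L p p' /\ delta_A p' (segment a' b') /\ 0 <= a' < b' /\ b' <= 1 /\
    forall z, segment a' b' z -> (b - a) / 8 < Rabs (v - z).
Proof.
  intros Hp Hab Hb.
  (* Outer endpoints beyond [[0,1]], so that the open interval also removes [b], respectively
     [a]. *)
  destruct (nu_dense 1 2) as [hi Hhi]; [lra|].
  destruct (nu_dense (-1) 0) as [lo Hlo]; [lra|].
  destruct (Rle_lt_dec ((a + b) / 2) v) as [Hv | Hv].
  - destruct (nu_dense a (a + (b - a) / 4)) as [d Hd]; [lra|].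
    destruct (delta_A_restrict p _ L (Cantor.to_nat (d, hi)) Hp) as [p' [Hag Hp']].
    exists p', a, (nu d). split; [exact Hag|]. split.
    { eapply delta_A_ext; [|exact Hp']. intros z. cbv beta. rewrite interval_of_to_nat.
      unfold segment. lra. }
    split; [lra|]. split; [lra|]. intros z Hz. unfold segment in Hz.
    rewrite Rabs_pos_eq; lra.
  - destruct (nu_dense (b - (b - a) / 4) b) as [d Hd]; [lra|].
    destruct (delta_A_restrict p _ L (Cantor.to_nat (lo, d)) Hp) as [p' [Hag Hp']].
    exists p', (nu d), b. split; [exact Hag|]. split.
    { eapply delta_A_ext; [|exact Hp']. intros z. cbv beta. rewrite interval_of_to_nat.
      unfold segment. lra. }
    split; [lra|]. split; [lra|]. intros z Hz. unfold segment in Hz.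
    rewrite Rabs_left; lra.
Qed.

Lemma agree_le (L L' : nat) (p q : name) : (L <= L')%nat -> agree L' p q -> agree L p q.
Proof. intros HL H n Hn. apply H. lia. Qed.

Lemma agree_pairing (L : nat) (p p' r r' : name) :
  agree L p p' -> agree L r r' -> agree L (pairing p r) (pairing p' r').
Proof.
  intros Hp Hr n Hn. unfold pairing.
  assert (Nat.div2 n < L)%nat by (apply Nat.le_lt_trans with (2 := Hn), Nat.div2_decr; lia).
  destruct (Nat.even n); auto.
Qed.

(** One sufficiently precise output digit depends on finite parts of the input and of the answer. If
    nearby inputs admit answers that keep that part of [r], the segment can be shrunk away from the
    digit while the digit stays the same. *)
Lemma no_stable_answer (eH eK : code) (p k r : name) (a b : R)
  (Hspec : forall p a b, delta_A p (segment a b) -> 0 <= a < b -> b <= 1 ->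
    exists k, comp_fun eK p k /\ (exists r, AUC_answer k r) /\
      forall r, AUC_answer k r ->
        exists o y, comp_fun eH (pairing p r) o /\ delta_C o y /\ segment a b y) :
  delta_A p (segment a b) -> 0 <= a < b -> b <= 1 ->
  comp_fun eK p k -> AUC_answer k r ->
  ~ (forall L, exists L', forall p' a' b' k', agree L' p p' ->
      delta_A p' (segment a' b') -> 0 <= a' < b' -> b' <= 1 ->
      comp_fun eK p' k' -> (exists r', AUC_answer k' r') ->
      exists r', agree L r r' /\ AUC_answer k' r').
Proof.
  intros Hp Hab Hb Hk Hr Hstable.
  destruct (Hspec p a b Hp Hab Hb) as [k0 [Hk0 [_ Hans]]].
  assert (k0 = k) as ->.
  { apply functional_extensionality. intros n. exact (eval_functional _ _ _ _ (Hk0 n) _ (Hk n)). }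
  destruct (Hans r Hr) as [o [y [Ho _]]].
  (* Digit [m] errs by less than the distance that [subsegment_away] provides. *)
  destruct (inv_pow2_small ((b - a) / 8)) as [m Hm]; [lra|].
  destruct (eval_use _ _ _ _ (Ho m)) as [L HL].
  destruct (Hstable L) as [L' HL'].
  destruct (subsegment_away p a b (nu (o m)) (Nat.max L L') Hp Hab Hb)
    as [p' [a' [b' [Hag [Hp' [Hab' [Hb' Haway]]]]]]].
  destruct (Hspec p' a' b' Hp' Hab' Hb') as [k' [Hk' [Hex Hans']]].
  destruct (HL' p' a' b' k') as [r' [Hrr' Hr']]; try assumption.
  { apply agree_le with (2 := Hag). lia. }
  destruct (Hans' r' Hr') as [o' [y' [Ho' [[_ Hy'] Hseg]]]].
  assert (o' m = o m) as Hom.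
  { apply (eval_functional _ _ _ _ (Ho' m)). apply HL, agree_pairing; [|exact Hrr'].
    apply agree_le with (2 := Hag). lia. }
  specialize (Hy' m). rewrite Hom in Hy'. specialize (Haway y' Hseg). lra.
Qed.

Lemma comp_fun_use (e : code) (p k : name) (N : nat) :
  comp_fun e p k -> exists L, forall p' k', agree L p p' -> comp_fun e p' k' -> agree N k k'.
Proof.
  intros Hk. induction N as [|N [L IH]].
  - exists 0%nat. intros p' k' _ _ n Hn. lia.
  - destruct (eval_use _ _ _ _ (Hk N)) as [L' HL'].
    exists (Nat.max L L'). intros p' k' Hp Hk' n Hn.
    destruct (Nat.eq_dec n N) as [-> | HnN].
    + symmetry. apply (eval_functional _ _ _ _ (Hk' N)), HL'.
      apply agree_le with (2 := Hp). lia.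
    + apply (IH p' k'); [|exact Hk'|lia]. apply agree_le with (2 := Hp). lia.
Qed.

Lemma not_W_le_PCC_AUC : ~ W_le delta_A delta_C PCC01 delta_A delta_C AUC01.
Proof.
  intros [eH [eK Hred]].
  pose proof (W_le_PCC_AUC_spec eH eK Hred) as Hspec.
  assert (in01_segment : forall z, in01 z <-> segment 0 1 z)
    by (intros z; unfold in01, segment; tauto).
  (* Either some segment name is mapped to a name of a singleton, or every query names the full
     interval. *)
  destruct (classic (exists p a b k B x, delta_A p (segment a b) /\ (0 <= a < b /\ b <= 1) /\
     comp_fun eK p k /\ delta_A k B /\ in01 x /\ forall z, B z <-> z = x))
    as [[p [a [b [k [B [x [Hp [[Hab Hb] [Hk [HkB [Hx HB]]]]]]]]]]] | Hno].
  - destruct (sharp_name x) as [r Hr].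
    apply (no_stable_answer eH eK p k r a b Hspec Hp Hab Hb Hk).
    { exists B, x. split; [exact HkB|]. split; [split; [right; now exists x | now apply HB]|].
      split; [exact Hx|]. intros n. apply Rle_trans with (1 := Hr n), inv_pow2_le. lia. }
    intros L. pose proof (inv_pow2_pos (S L)) as Hpos.
    (* Radius at most [1/4] excludes the answer set [[0,1]]; radius at most [2^-(L+1)] matches the
       slack in the sharp name [r]. *)
    destruct (delta_A_singleton_lebesgue k B x (Rmin (/ 4) (/ 2 ^ S L)) HkB HB) as [N [d [Hd HN]]].
    { apply Rmin_pos; lra. }
    pose proof (Rmin_l (/ 4) (/ 2 ^ S L)) as Hl. pose proof (Rmin_r (/ 4) (/ 2 ^ S L)) as Hr'.
    destruct (comp_fun_use eK p k N Hk) as [L' HL'].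
    exists L'. intros p' a' b' k' Hag _ _ _ Hk' [_ [B' [y' [HkB' [[Hdom Hy'] _]]]]].
    specialize (HL' p' k' Hag Hk').
    (* The first [N] entries of [k] remove everything outside the ball, and [k'] shares them. *)
    assert (Hnear : forall z, B' z -> Rabs (z - x) < Rmin (/ 4) (/ 2 ^ S L)).
    { intros z Hz. pose proof (proj1 HkB' z Hz) as Hz01.
      assert (H0 : Rabs (z - z) < d) by (rewrite Rminus_diag, Rabs_R0; exact Hd).
      destruct (HN z Hz01) as [Hw | [n [Hn Hw]]]; [exact (Hw z H0)|].
      exfalso. apply (proj2 (delta_A_removes k' B' z HkB' Hz01)); [|exact Hz].
      exists n. destruct (Hw z H0) as [c Hc]. exists c. now rewrite <- (HL' n Hn). }
    destruct Hdom as [Hfull | [x' [Hx' HB']]].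
    { assert (H0 := Hnear 0 (proj2 (Hfull 0) ltac:(unfold in01; lra))).
      assert (H1 := Hnear 1 (proj2 (Hfull 1) ltac:(unfold in01; lra))).
      apply Rabs_def2 in H0. apply Rabs_def2 in H1. lra. }
    destruct (sharp_name x') as [q Hq].
    (* The first [L] digits of [r] continued by a name of [x']. For [n < L] the error is at most
       [2^-(n+1) + 2^-(L+1) <= 2^-n]. *)
    exists (fun n => if (n <? L)%nat then r n else q n). split.
    { intros n Hn. apply Nat.ltb_lt in Hn. now rewrite Hn. }
    exists B', x'. split; [exact HkB'|]. split; [split; [right; now exists x' | now apply HB']|].
    split; [exact Hx'|]. intros n.
    destruct (Nat.ltb_spec n L) as [Hn | Hn].
    + specialize (Hnear x' (proj2 (HB' x') eq_refl)).
      replace (nu (r n) - x') with ((nu (r n) - x) - (x' - x)) by ring.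
      apply Rle_trans with (1 := Rabs_triang _ _). rewrite Rabs_Ropp.
      specialize (Hr n). pose proof (inv_pow2_le (S n) (S L) ltac:(lia)).
      rewrite (inv_pow2_S n) in *. lra.
    + apply Rle_trans with (1 := Hq n), inv_pow2_le. lia.
  (* With no singleton query, a fixed name of 0 answers every query, so it is stable with no
     agreement of inputs at all. *)
  - assert (Hfull : forall p a b k, delta_A p (segment a b) -> 0 <= a < b -> b <= 1 ->
       comp_fun eK p k -> (exists r, AUC_answer k r) -> delta_A k in01).
    { intros p a b k Hp Hab Hb Hk [_ [B [_ [HkB [[[HB | [x [Hx HB]]] _] _]]]]].
      - exact (delta_A_ext k B in01 HB HkB).
      - exfalso. apply Hno. exists p, a, b, k, B, x. tauto. }
    destruct (sharp_name 0) as [r Hr].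
    assert (Hans : forall k, delta_A k in01 -> AUC_answer k r).
    { intros k Hk. exists in01, 0. split; [exact Hk|].
      assert (in01 0) by (unfold in01; lra).
      split; [split; [left; tauto | assumption]|]. split; [assumption|].
      intros n. apply Rle_trans with (1 := Hr n), inv_pow2_le. lia. }
    assert (Hp := delta_A_ext _ _ _ in01_segment delta_A_empty_name).
    destruct (Hspec _ 0 1 Hp) as [k [Hk [Hex _]]]; [lra | lra |].
    apply (no_stable_answer eH eK _ k r 0 1 Hspec Hp); [lra | lra | exact Hk | |].
    + apply Hans, (Hfull _ 0 1 k Hp); [lra | lra | exact Hk | exact Hex].
    + intros L. exists 0%nat. intros p' a' b' k' _ Hp' Hab' Hb' Hk' Hex'.
      exists r. split; [now intros n Hn|]. apply Hans, (Hfull p' a' b' k'); assumption.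
Qed.

(** * Closure properties of computable functionals *)
Local Open Scope nat_scope.

(* Environments are lists of exactly [k] arguments, the innermost bound variable first. *)
Definition computable (k : nat) (f : name -> list nat -> nat) : Prop :=
  exists c, forall p xs, length xs = k -> eval p c xs (f p xs).

Definition computable_bool (k : nat) (f : name -> list nat -> bool) : Prop :=
  computable k (fun p xs => Nat.b2n (f p xs)).

Lemma computable_ext (k : nat) (f g : name -> list nat -> nat) :
  (forall p xs, f p xs = g p xs) -> computable k f -> computable k g.
Proof. intros H [c Hc]. exists c. intros p xs Hxs. rewrite <- H. auto. Qed.

Lemma computable_succ (k : nat) (f : name -> list nat -> nat) :
  computable k f -> computable k (fun p xs => S (f p xs)).
Proof.
  intros [c Hc]. exists (CComp CSucc [c]). intros p xs Hxs.
  apply eComp with [f p xs]; [repeat constructor; auto | apply (eSucc p [f p xs])].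
Qed.

Lemma computable_const (k c : nat) : computable k (fun _ _ => c).
Proof.
  induction c as [|c IH]; [exists CZero; constructor | now apply computable_succ].
Qed.

(** Iterated tails rather than [nth], so that the terms [hd 0 (tl ...)] arising from environments
    match by conversion. *)
Lemma computable_var (k i : nat) :
  computable k (fun _ xs => hd 0 (Nat.iter i (@tl nat) xs)).
Proof.
  exists (CProj i). intros p xs _.
  assert (hd 0 (Nat.iter i (@tl nat) xs) = nth i xs 0) as ->; [|constructor].
  revert xs. induction i as [|i IH]; intros xs; [now destruct xs|].
  rewrite Nat.iter_succ_r, IH. now destruct xs; destruct i.
Qed.

Lemma computable_oracle (k : nat) (f : name -> list nat -> nat) :
  computable k f -> computable k (fun p xs => p (f p xs)).
Proof.
  intros [c Hc]. exists (CComp COracle [c]). intros p xs Hxs.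
  apply eComp with [f p xs]; [repeat constructor; auto | apply (eOracle p [f p xs])].
Qed.

(** The list of projections passes a whole environment on to a composed code. *)
Lemma Forall2_proj (p : name) (xs : list nat) :
  Forall2 (fun g y => eval p g xs y) (map CProj (seq 0 (length xs))) xs.
Proof.
  assert (H : forall ys pre, xs = pre ++ ys ->
    Forall2 (fun g y => eval p g xs y) (map CProj (seq (length pre) (length ys))) ys).
  { induction ys as [|y ys IH]; intros pre Hxs; constructor.
    - replace y with (nth (length pre) xs 0); [constructor|].
      rewrite Hxs, app_nth2, Nat.sub_diag; [reflexivity | lia].
    - specialize (IH (pre ++ [y])). rewrite length_app, Nat.add_1_r in IH. apply IH.
      now rewrite <- app_assoc. }
  exact (H xs [] eq_refl).
Qed.

(** The workhorse of this part: arithmetic and bounded search below are rewritten as instances of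
    [nat_rect]. As in [ePRS], the step sees the counter first and the previous value second. *)
Lemma computable_nat_rect (k : nat) (b f : name -> list nat -> nat)
    (g : name -> list nat -> nat -> nat -> nat) :
  computable k b -> computable k f ->
  computable (S (S k)) (fun p ys => g p (tl (tl ys)) (hd 0 ys) (hd 0 (tl ys))) ->
  computable k (fun p xs => nat_rect (fun _ => nat) (f p xs) (g p xs) (b p xs)).
Proof.
  intros [cb Hb] [cf Hf] [cg Hg].
  exists (CComp (CPrimRec cf cg) (cb :: map CProj (seq 0 k))). intros p xs Hxs.
  apply eComp with (b p xs :: xs).
  - constructor; [auto | rewrite <- Hxs; apply Forall2_proj].
  - induction (b p xs) as [|n IH]; simpl.
    + constructor. auto.
    + eapply ePRS; [exact IH|].
      apply (Hg p (n :: _ :: xs)). simpl. now rewrite Hxs.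
Qed.

Ltac computable_vars :=
  first [ exact (computable_var _ 0) | exact (computable_var _ 1) | exact (computable_var _ 2)
        | exact (computable_var _ 3) | exact (computable_var _ 4) | exact (computable_var _ 5)
        | exact (computable_var _ 6) | exact (computable_var _ 7) | exact (computable_var _ 8)
        | exact (computable_var _ 9) | exact (computable_var _ 10) | exact (computable_var _ 11)
        | exact (computable_var _ 12) | exact (computable_var _ 13) | exact (computable_var _ 14) ].

Lemma computable_weaken2 (k : nat) (f : name -> list nat -> nat) :
  computable k f -> computable (S (S k)) (fun p ys => f p (tl (tl ys))).
Proof.
  intros [c Hc]. exists (CComp c (map CProj (seq 2 k))). intros p [|y [|z ys]] Hys;
    try discriminate. injection Hys as Hys. apply eComp with ys; [|auto].
  pose proof (Forall2_proj p (y :: z :: ys)) as H. simpl in H. rewrite Hys in H.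
  inversion H as [|? ? ? ? _ H1]. now inversion H1.
Qed.

Lemma computable_add (k : nat) (f g : name -> list nat -> nat) :
  computable k f -> computable k g -> computable k (fun p xs => f p xs + g p xs).
Proof.
  intros Hf Hg.
  apply computable_ext with
    (fun p xs => nat_rect (fun _ => nat) (g p xs) (fun _ r => S r) (f p xs)).
  - intros p xs. induction (f p xs); simpl; congruence.
  - apply (computable_nat_rect k f g (fun _ _ _ r => S r)); auto.
    apply computable_succ. computable_vars.
Qed.

Lemma computable_mul (k : nat) (f g : name -> list nat -> nat) :
  computable k f -> computable k g -> computable k (fun p xs => f p xs * g p xs).
Proof.
  intros Hf Hg.
  apply computable_ext with
    (fun p xs => nat_rect (fun _ => nat) 0 (fun _ r => g p xs + r) (f p xs)).
  - intros p xs. induction (f p xs); simpl; congruence.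
  - apply (computable_nat_rect k f _ (fun p xs _ r => g p xs + r)); auto.
    + apply computable_const.
    + apply computable_add; [exact (computable_weaken2 k g Hg) | computable_vars].
Qed.

Lemma computable_pow2 (k : nat) (f : name -> list nat -> nat) :
  computable k f -> computable k (fun p xs => 2 ^ f p xs).
Proof.
  intros Hf.
  apply computable_ext with
    (fun p xs => nat_rect (fun _ => nat) 1 (fun _ r => 2 * r) (f p xs)).
  - intros p xs. induction (f p xs); simpl in *; congruence.
  - apply (computable_nat_rect k f _ (fun p xs _ r => 2 * r)); auto.
    + apply computable_const.
    + apply computable_mul; [apply computable_const | computable_vars].
Qed.

Lemma computable_pred (k : nat) (f : name -> list nat -> nat) :
  computable k f -> computable k (fun p xs => Nat.pred (f p xs)).
Proof.
  intros Hf.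
  apply computable_ext with (fun p xs => nat_rect (fun _ => nat) 0 (fun n _ => n) (f p xs)).
  - intros p xs. now destruct (f p xs).
  - apply (computable_nat_rect k f _ (fun p xs n _ => n)); auto.
    + apply computable_const.
    + computable_vars.
Qed.

Lemma computable_sub (k : nat) (f g : name -> list nat -> nat) :
  computable k f -> computable k g -> computable k (fun p xs => f p xs - g p xs).
Proof.
  intros Hf Hg.
  apply computable_ext with
    (fun p xs => nat_rect (fun _ => nat) (f p xs) (fun _ r => Nat.pred r) (g p xs)).
  - intros p xs. induction (g p xs); simpl; lia.
  - apply (computable_nat_rect k g f (fun p xs _ r => Nat.pred r)); auto.
    apply computable_pred. computable_vars.
Qed.

Lemma computable_if (k : nat) (b : name -> list nat -> bool) (f g : name -> list nat -> nat) :
  computable_bool k b -> computable k f -> computable k g ->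
  computable k (fun p xs => if b p xs then f p xs else g p xs).
Proof.
  intros Hb Hf Hg.
  apply computable_ext with
    (fun p xs => nat_rect (fun _ => nat) (g p xs) (fun _ _ => f p xs) (Nat.b2n (b p xs))).
  - intros p xs. now destruct (b p xs).
  - apply (computable_nat_rect k _ g (fun p xs _ _ => f p xs)); auto.
    exact (computable_weaken2 k f Hf).
Qed.

Lemma computable_bool_ext (k : nat) (f g : name -> list nat -> bool) :
  (forall p xs, f p xs = g p xs) -> computable_bool k f -> computable_bool k g.
Proof. intros H. apply computable_ext. intros. now rewrite H. Qed.

Lemma computable_bool_if (k : nat) (b f g : name -> list nat -> bool) :
  computable_bool k b -> computable_bool k f -> computable_bool k g ->
  computable_bool k (fun p xs => if b p xs then f p xs else g p xs).
Proof.
  intros Hb Hf Hg.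
  apply computable_ext with (fun p xs => if b p xs then Nat.b2n (f p xs) else Nat.b2n (g p xs)).
  - intros p xs. now destruct (b p xs).
  - now apply computable_if.
Qed.

Lemma computable_bool_const (k : nat) (b : bool) : computable_bool k (fun _ _ => b).
Proof. exact (computable_const k (Nat.b2n b)). Qed.

Lemma computable_negb (k : nat) (f : name -> list nat -> bool) :
  computable_bool k f -> computable_bool k (fun p xs => negb (f p xs)).
Proof. intros Hf. apply computable_bool_if; auto using computable_bool_const. Qed.

Lemma computable_andb (k : nat) (f g : name -> list nat -> bool) :
  computable_bool k f -> computable_bool k g ->
  computable_bool k (fun p xs => f p xs && g p xs)%bool.
Proof. intros Hf Hg. apply computable_bool_if; auto using computable_bool_const. Qed.

Lemma computable_orb (k : nat) (f g : name -> list nat -> bool) :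
  computable_bool k f -> computable_bool k g ->
  computable_bool k (fun p xs => f p xs || g p xs)%bool.
Proof. intros Hf Hg. apply computable_bool_if; auto using computable_bool_const. Qed.

Lemma computable_leb (k : nat) (f g : name -> list nat -> nat) :
  computable k f -> computable k g -> computable_bool k (fun p xs => f p xs <=? g p xs).
Proof.
  intros Hf Hg. apply computable_ext with (fun p xs => 1 - (f p xs - g p xs)).
  - intros p xs. destruct (Nat.leb_spec (f p xs) (g p xs)); cbn [Nat.b2n]; lia.
  - apply computable_sub; [apply computable_const | now apply computable_sub].
Qed.

Lemma computable_ltb (k : nat) (f g : name -> list nat -> nat) :
  computable k f -> computable k g -> computable_bool k (fun p xs => f p xs <? g p xs).
Proof. intros Hf Hg. apply computable_leb; [now apply computable_succ | exact Hg]. Qed.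

Lemma computable_eqb (k : nat) (f g : name -> list nat -> nat) :
  computable k f -> computable k g -> computable_bool k (fun p xs => f p xs =? g p xs).
Proof.
  intros Hf Hg.
  apply computable_bool_ext with (fun p xs => (f p xs <=? g p xs) && (g p xs <=? f p xs))%bool.
  - intros p xs. destruct (Nat.eqb_spec (f p xs) (g p xs)), (Nat.leb_spec (f p xs) (g p xs)),
      (Nat.leb_spec (g p xs) (f p xs)); simpl; lia.
  - now apply computable_andb; apply computable_leb.
Qed.

(** The value [n] stands for failure, which is what [bounded_ex] tests for. *)
Fixpoint bounded_min (n : nat) (P : nat -> bool) : nat :=
  match n with
  | 0 => 0
  | S n => if bounded_min n P <? n then bounded_min n P else if P n then n else S n
  end.

Definition bounded_ex (n : nat) (P : nat -> bool) : bool := bounded_min n P <? n.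

Lemma bounded_min_spec (n : nat) (P : nat -> bool) :
  (forall i, i < bounded_min n P -> P i = false) /\
  bounded_min n P <= n /\ (bounded_min n P < n -> P (bounded_min n P) = true).
Proof.
  induction n as [|n [IH1 [IH2 IH3]]]; simpl; [repeat split; intros; lia|].
  destruct (Nat.ltb_spec (bounded_min n P) n) as [Hn | Hn]; [auto|].
  assert (bounded_min n P = n) as E by lia. rewrite E in *.
  destruct (P n) eqn:HP; [auto|].
  split; [|lia]. intros i Hi. destruct (Nat.eq_dec i n) as [-> |]; [exact HP | apply IH1; lia].
Qed.

Lemma bounded_ex_spec (n : nat) (P : nat -> bool) :
  bounded_ex n P = true <-> exists i, i < n /\ P i = true.
Proof.
  destruct (bounded_min_spec n P) as [H1 [H2 H3]]. unfold bounded_ex. rewrite Nat.ltb_lt. split.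
  - intros H. exists (bounded_min n P). auto.
  - intros [i [Hi HP]]. apply Nat.nle_gt. intros Hn. rewrite H1 in HP; [discriminate | lia].
Qed.

Lemma computable_bounded_min (k : nat) (b : name -> list nat -> nat)
    (P : name -> list nat -> nat -> bool) :
  computable k b -> computable_bool (S k) (fun p ys => P p (tl ys) (hd 0 ys)) ->
  computable k (fun p xs => bounded_min (b p xs) (P p xs)).
Proof.
  intros Hb HP.
  apply computable_ext with (fun p xs => nat_rect (fun _ => nat) 0
    (fun n r => if r <? n then r else if P p xs n then n else S n) (b p xs)).
  { intros p xs. induction (b p xs) as [|n IH]; [reflexivity|]. simpl. now rewrite IH. }
  apply (computable_nat_rect k b _
    (fun p xs n r => if r <? n then r else if P p xs n then n else S n)); auto.
  { apply computable_const. }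
  apply computable_if; [apply computable_ltb; computable_vars | computable_vars |].
  apply computable_if; [|computable_vars | apply computable_succ; computable_vars].
  (* [P] expects the candidate on top of the original environment, so the previous value of the
     recursion is skipped. *)
  destruct HP as [c Hc]. exists (CComp c (CProj 0 :: map CProj (seq 2 k))).
  intros p [|n [|r xs]] Hxs; try discriminate. injection Hxs as Hxs.
  apply eComp with (n :: xs); [|apply (Hc p (n :: xs)); simpl; now rewrite Hxs].
  pose proof (Forall2_proj p (n :: r :: xs)) as H. simpl in H. rewrite Hxs in H.
  inversion H as [|? ? ? ? H0 H1]. inversion H1. now constructor.
Qed.

Lemma computable_bounded_ex (k : nat) (b : name -> list nat -> nat)
    (P : name -> list nat -> nat -> bool) :
  computable k b -> computable_bool (S k) (fun p ys => P p (tl ys) (hd 0 ys)) ->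
  computable_bool k (fun p xs => bounded_ex (b p xs) (P p xs)).
Proof. intros Hb HP. apply computable_ltb; [now apply computable_bounded_min | exact Hb]. Qed.

Lemma computable_to_nat (k : nat) (f g : name -> list nat -> nat) :
  computable k f -> computable k g ->
  computable k (fun p xs => Cantor.to_nat (f p xs, g p xs)).
Proof.
  intros Hf Hg.
  (* [Cantor.to_nat] unfolds to the second component plus the triangular number of the sum. *)
  apply (computable_add k g (fun p xs => nat_rect (fun _ => nat) 0
           (fun i m => S i + m) (g p xs + f p xs))); [exact Hg|].
  apply (computable_nat_rect k _ _ (fun p xs i m => S i + m)).
  - now apply computable_add.
  - apply computable_const.
  - apply computable_add; [apply computable_succ|]; computable_vars.
Qed.

(** Substitution: a functional is proved computable once on bare variables, and its arguments are
    plugged in afterwards. *)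
Lemma computable_comp (k : nat) (F : name -> list nat -> nat)
    (fs : list (name -> list nat -> nat)) :
  computable (length fs) F -> Forall (computable k) fs ->
  computable k (fun p xs => F p (map (fun f => f p xs) fs)).
Proof.
  intros [c Hc] Hfs.
  assert (exists cs, forall p xs, length xs = k ->
    Forall2 (fun g y => eval p g xs y) cs (map (fun f => f p xs) fs)) as [cs Hcs].
  { clear Hc. induction Hfs as [|f fs [d Hd] _ [cs Hcs]].
    - exists []. constructor.
    - exists (d :: cs). intros p xs Hxs. constructor; auto. }
  exists (CComp c cs). intros p xs Hxs.
  eapply eComp; [now apply Hcs | apply Hc, length_map].
Qed.

(** The inverse of the pairing is found by bounded search, since both components are at most the
    code. *)
Lemma computable_fst_of_nat (k : nat) (f : name -> list nat -> nat) :
  computable k f -> computable k (fun p xs => fst (Cantor.of_nat (f p xs))).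
Proof.
  intros Hf.
  apply (computable_comp k (fun _ xs => fst (Cantor.of_nat (hd 0 xs))) [f]); [|now constructor].
  apply computable_ext with (fun p xs => bounded_min (S (hd 0 xs)) (fun x =>
    bounded_ex (S (hd 0 xs)) (fun y => Cantor.to_nat (x, y) =? hd 0 xs))).
  - intros _ xs. generalize (hd 0 xs). clear xs. intros n.
    destruct (Cantor.of_nat n) as [x y] eqn:E. simpl fst.
    assert (Hn : n = Cantor.to_nat (x, y)) by (rewrite <- E; symmetry; apply Cantor.cancel_to_of).
    pose proof (Cantor.to_nat_non_decreasing x y) as Hle.
    set (P := fun x => _).
    assert (HP : forall i, P i = true -> i = x).
    { intros i Hi. apply bounded_ex_spec in Hi. destruct Hi as [j [_ Hj]].
      apply Nat.eqb_eq in Hj. rewrite Hn in Hj. apply Cantor.to_nat_inj in Hj. congruence. }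
    assert (Hx : P x = true).
    { apply bounded_ex_spec. exists y. split; [lia|]. apply Nat.eqb_eq. auto. }
    destruct (bounded_min_spec (S n) P) as [H1 [_ H3]]. apply HP, H3.
    apply Nat.nle_gt. intros Hb. rewrite H1 in Hx; [discriminate | lia].
  - apply (computable_bounded_min 1 _ (fun p xs x =>
      bounded_ex (S (hd 0 xs)) (fun y => Cantor.to_nat (x, y) =? hd 0 xs))).
    { apply computable_succ. computable_vars. }
    apply (computable_bounded_ex 2 _ (fun p xs y =>
      Cantor.to_nat (hd 0 xs, y) =? hd 0 (tl xs))).
    { apply computable_succ. computable_vars. }
    apply computable_eqb; [apply computable_to_nat|]; computable_vars.
Qed.

Lemma computable_snd_of_nat (k : nat) (f : name -> list nat -> nat) :
  computable k f -> computable k (fun p xs => snd (Cantor.of_nat (f p xs))).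
Proof.
  intros Hf.
  apply (computable_comp k (fun _ xs => snd (Cantor.of_nat (hd 0 xs))) [f]); [|now constructor].
  apply computable_ext with (fun p xs => bounded_min (S (hd 0 xs)) (fun y =>
    Cantor.to_nat (fst (Cantor.of_nat (hd 0 xs)), y) =? hd 0 xs)).
  - intros _ xs. generalize (hd 0 xs). clear xs. intros n.
    destruct (Cantor.of_nat n) as [x y] eqn:E. simpl fst. simpl snd.
    assert (Hn : n = Cantor.to_nat (x, y)) by (rewrite <- E; symmetry; apply Cantor.cancel_to_of).
    pose proof (Cantor.to_nat_non_decreasing x y) as Hle.
    set (P := fun y => _).
    assert (HP : forall i, P i = true -> i = y).
    { intros i Hj. apply Nat.eqb_eq in Hj. rewrite Hn in Hj. apply Cantor.to_nat_inj in Hj. congruence. }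
    assert (Hy : P y = true) by (apply Nat.eqb_eq; auto).
    destruct (bounded_min_spec (S n) P) as [H1 [_ H3]]. apply HP, H3.
    apply Nat.nle_gt. intros Hb. rewrite H1 in Hy; [discriminate | lia].
  - apply (computable_bounded_min 1 _ (fun p xs y =>
      Cantor.to_nat (fst (Cantor.of_nat (hd 0 xs)), y) =? hd 0 xs)).
    { apply computable_succ. computable_vars. }
    apply computable_eqb; [apply computable_to_nat|]; try computable_vars.
    apply computable_fst_of_nat. computable_vars.
Qed.

(* The unbounded search in front of a total function yields the partial functionals. *)
Lemma mu_code (t : name -> list nat -> bool) (g : name -> list nat -> nat) :
  computable_bool 2 t -> computable 2 g ->
  exists e, forall p n w, t p [w; n] = true -> (forall v, v < w -> t p [v; n] = false) ->
    eval p e [n] (g p [w; n]).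
Proof.
  intros Ht [cg Hg]. apply computable_negb in Ht. destruct Ht as [ct Ht].
  exists (CComp cg [CMu ct; CProj 0]). intros p n w Hw Hlt.
  apply eComp with [w; n]; [|now apply Hg].
  constructor; [|constructor; [apply (eProj p 0 [n]) | constructor]].
  constructor.
  - specialize (Ht p [w; n] eq_refl). now rewrite Hw in Ht.
  - intros v Hv. exists 0. specialize (Ht p [v; n] eq_refl). now rewrite (Hlt v Hv) in Ht.
Qed.

(** * The reduction of AUC to PCC *)

(** Compares [nu a] with [u/(N+1)] by cross multiplication; the subtracted part of the numerator
    moves to the other side to stay within the naturals. *)
Definition nu_ltb (a u N : nat) : bool :=
  let a1 := Cantor.of_nat a in
  let a2 := Cantor.of_nat (snd a1) in
  fst a1 * S N <? u * S (snd a2) + fst a2 * S N.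

Definition nu_gtb (a u N : nat) : bool :=
  let a1 := Cantor.of_nat a in
  let a2 := Cantor.of_nat (snd a1) in
  u * S (snd a2) + fst a2 * S N <? fst a1 * S N.

(* One of the first [N] intervals listed by [p] covers the closed cell [i/(N+1), (i+1)/(N+1)]. *)
Definition covered (p : name) (N i : nat) : bool :=
  bounded_ex N (fun j => negb (p j =? 0) &&
    (nu_ltb (fst (Cantor.of_nat (pred (p j)))) i N &&
     nu_gtb (snd (Cantor.of_nat (pred (p j)))) (S i) N))%bool.

Definition detected (p : name) (s : nat) : bool := bounded_ex (S s) (covered p s).

(** An interval that covers a cell of one grid may cover none of the next, so [detected] need not
    persist; collecting all stages up to [n] makes it monotone. *)
Definition seen (p : name) (n : nat) : bool := bounded_ex (S n) (detected p).

Definition first_seen (p : name) (n : nat) : nat := bounded_min (S n) (detected p).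

(* Every cell that is not covered lies within [2^-m] of [i/(N+1)]. *)
Definition located (p : name) (m N i : nat) : bool :=
  negb (bounded_ex (S N) (fun j =>
    negb (covered p N j || (S ((j - i) + (i - j)) * 2 ^ m <=? S N)))).

Definition location (p : name) (m N : nat) : nat := bounded_min (S N) (located p m N).

(** As long as nothing is seen the search must stop at once: on the input [[0,1]] a location may
    never be found. *)
Definition search_done (p : name) (m n N : nat) : bool :=
  (negb (seen p n) || bounded_ex (S N) (located p m N))%bool.

(** * Computability of the grid searches *)

Lemma computable_nu_ltb (k : nat) (a u N : name -> list nat -> nat) :
  computable k a -> computable k u -> computable k N ->
  computable_bool k (fun p xs => nu_ltb (a p xs) (u p xs) (N p xs)).
Proof.
  intros Ha Hu HN. unfold nu_ltb.
  apply computable_ltb; repeat first [apply computable_add | apply computable_mul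
    | apply computable_succ | apply computable_fst_of_nat | apply computable_snd_of_nat]; assumption.
Qed.

Lemma computable_nu_gtb (k : nat) (a u N : name -> list nat -> nat) :
  computable k a -> computable k u -> computable k N ->
  computable_bool k (fun p xs => nu_gtb (a p xs) (u p xs) (N p xs)).
Proof.
  intros Ha Hu HN. unfold nu_gtb.
  apply computable_ltb; repeat first [apply computable_add | apply computable_mul
    | apply computable_succ | apply computable_fst_of_nat | apply computable_snd_of_nat]; assumption.
Qed.

(** Abstracts how the input name is read: it is the oracle itself for the forward functional and the
    even half of a pairing for the backward one. *)
Definition computable_access (ora : name -> name) : Prop :=
  forall k f, computable k f -> computable k (fun p xs => ora p (f p xs)).

Ltac computable_step :=
  match goal with
  | |- computable _ (fun _ _ => ?c) => apply computable_const
  | |- computable _ _ => computable_vars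
  | H : computable_access ?o |- computable _ (fun p xs => ?o p (@?f p xs)) => apply (H _ f)
  | |- computable _ (fun p xs => S (@?f p xs)) => apply (computable_succ _ f)
  | |- computable _ (fun p xs => Nat.pred (@?f p xs)) => apply (computable_pred _ f)
  | |- computable _ (fun p xs => Nat.add (@?f p xs) (@?g p xs)) => apply (computable_add _ f g)
  | |- computable _ (fun p xs => Nat.mul (@?f p xs) (@?g p xs)) => apply (computable_mul _ f g)
  | |- computable _ (fun p xs => Nat.sub (@?f p xs) (@?g p xs)) => apply (computable_sub _ f g)
  | |- computable _ (fun p xs => Nat.pow 2 (@?f p xs)) => apply (computable_pow2 _ f)
  | |- computable _ (fun p xs => Cantor.to_nat (@?f p xs, @?g p xs)) =>
      apply (computable_to_nat _ f g)
  | |- computable _ (fun p xs => fst (Cantor.of_nat (@?f p xs))) =>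
      apply (computable_fst_of_nat _ f)
  | |- computable _ (fun p xs => snd (Cantor.of_nat (@?f p xs))) =>
      apply (computable_snd_of_nat _ f)
  | |- computable _ (fun p xs => if @?b p xs then @?f p xs else @?g p xs) =>
      apply (computable_if _ b f g)
  | |- computable _ (fun p xs => bounded_min (@?b p xs) (@?P p xs)) =>
      apply (computable_bounded_min _ b P)
  | |- computable_bool _ (fun p xs => bounded_ex (@?b p xs) (@?P p xs)) =>
      apply (computable_bounded_ex _ b P)
  | |- computable_bool _ (fun p xs => negb (@?f p xs)) => apply (computable_negb _ f)
  | |- computable_bool _ (fun p xs => andb (@?f p xs) (@?g p xs)) => apply (computable_andb _ f g)
  | |- computable_bool _ (fun p xs => orb (@?f p xs) (@?g p xs)) => apply (computable_orb _ f g)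
  | |- computable_bool _ (fun p xs => Nat.eqb (@?f p xs) (@?g p xs)) => apply (computable_eqb _ f g)
  | |- computable_bool _ (fun p xs => Nat.ltb (@?f p xs) (@?g p xs)) => apply (computable_ltb _ f g)
  | |- computable_bool _ (fun p xs => Nat.leb (@?f p xs) (@?g p xs)) => apply (computable_leb _ f g)
  | |- computable_bool _ (fun p xs => nu_ltb (@?f p xs) (@?g p xs) (@?h p xs)) =>
      apply (computable_nu_ltb _ f g h)
  | |- computable_bool _ (fun p xs => nu_gtb (@?f p xs) (@?g p xs) (@?h p xs)) =>
      apply (computable_nu_gtb _ f g h)
  end.

Ltac computable_tac := repeat (computable_step; cbv beta).

Lemma computable_covered (ora : name -> name) (k : nat) (N i : name -> list nat -> nat) :
  computable_access ora -> computable k N -> computable k i ->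
  computable_bool k (fun p xs => covered (ora p) (N p xs) (i p xs)).
Proof.
  intros Ho HN Hi.
  apply (computable_comp k (fun p xs => Nat.b2n (covered (ora p) (hd 0 xs) (hd 0 (tl xs)))) [N; i]);
    [|repeat constructor; assumption].
  change (computable_bool 2 (fun p xs => covered (ora p) (hd 0 xs) (hd 0 (tl xs)))).
  unfold covered. computable_tac.
Qed.

Lemma computable_detected (ora : name -> name) (k : nat) (s : name -> list nat -> nat) :
  computable_access ora -> computable k s ->
  computable_bool k (fun p xs => detected (ora p) (s p xs)).
Proof.
  intros Ho Hs.
  apply (computable_comp k (fun p xs => Nat.b2n (detected (ora p) (hd 0 xs))) [s]);
    [|repeat constructor; assumption].
  change (computable_bool 1 (fun p xs => detected (ora p) (hd 0 xs))).
  unfold detected. computable_tac. apply computable_covered; computable_tac; exact Ho.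
Qed.

Lemma computable_seen (ora : name -> name) (k : nat) (n : name -> list nat -> nat) :
  computable_access ora -> computable k n ->
  computable_bool k (fun p xs => seen (ora p) (n p xs)).
Proof.
  intros Ho Hn. unfold seen.
  apply (computable_bounded_ex k (fun p xs => S (n p xs)) (fun p xs => detected (ora p))).
  - now apply computable_succ.
  - apply computable_detected; computable_tac; exact Ho.
Qed.

Lemma computable_first_seen (ora : name -> name) (k : nat) (n : name -> list nat -> nat) :
  computable_access ora -> computable k n ->
  computable k (fun p xs => first_seen (ora p) (n p xs)).
Proof.
  intros Ho Hn. unfold first_seen.
  apply (computable_bounded_min k (fun p xs => S (n p xs)) (fun p xs => detected (ora p))).
  - now apply computable_succ.
  - apply computable_detected; computable_tac; exact Ho.
Qed.

Lemma computable_located (ora : name -> name) (k : nat) (m N i : name -> list nat -> nat) :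
  computable_access ora -> computable k m -> computable k N -> computable k i ->
  computable_bool k (fun p xs => located (ora p) (m p xs) (N p xs) (i p xs)).
Proof.
  intros Ho Hm HN Hi.
  apply (computable_comp k (fun p xs =>
      Nat.b2n (located (ora p) (hd 0 xs) (hd 0 (tl xs)) (hd 0 (tl (tl xs))))) [m; N; i]);
    [|repeat constructor; assumption].
  change (computable_bool 3 (fun p xs =>
    located (ora p) (hd 0 xs) (hd 0 (tl xs)) (hd 0 (tl (tl xs))))).
  unfold located. computable_tac. apply computable_covered; computable_tac; exact Ho.
Qed.

Lemma computable_location (ora : name -> name) (k : nat) (m N : name -> list nat -> nat) :
  computable_access ora -> computable k m -> computable k N ->
  computable k (fun p xs => location (ora p) (m p xs) (N p xs)).
Proof.
  intros Ho Hm HN.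
  apply (computable_comp k (fun p xs => location (ora p) (hd 0 xs) (hd 0 (tl xs))) [m; N]);
    [|repeat constructor; assumption].
  change (computable 2 (fun p xs => location (ora p) (hd 0 xs) (hd 0 (tl xs)))).
  unfold location. computable_tac. apply computable_located; computable_tac; exact Ho.
Qed.

Lemma computable_search_done (ora : name -> name) (k : nat) (m n N : name -> list nat -> nat) :
  computable_access ora -> computable k m -> computable k n -> computable k N ->
  computable_bool k (fun p xs => search_done (ora p) (m p xs) (n p xs) (N p xs)).
Proof.
  intros Ho Hm Hn HN.
  apply (computable_comp k (fun p xs =>
      Nat.b2n (search_done (ora p) (hd 0 xs) (hd 0 (tl xs)) (hd 0 (tl (tl xs))))) [m; n; N]);
    [|repeat constructor; assumption].
  change (computable_bool 3 (fun p xs =>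
    search_done (ora p) (hd 0 xs) (hd 0 (tl xs)) (hd 0 (tl (tl xs))))).
  unfold search_done. computable_tac.
  - apply computable_seen; computable_tac; exact Ho.
  - apply computable_located; computable_tac; exact Ho.
Qed.

(* From the detection stage [s] on, lists the intervals [(-1, q - 2*2^-m)] (once) and
   [(q + 2*2^-m, 2)], where [m = s+2] and [q] is a grid point within [2^-m] of the singleton;
   the factor 2 keeps the remaining segment nondegenerate even when the point is 0 or 1. *)
Definition K_output (p : name) (n N : nat) : nat :=
  if seen p n then
    let s := first_seen p n in
    let m := S (S s) in
    let i := location p m N in
    S (if n =? s
       then Cantor.to_nat (Cantor.to_nat (0, Cantor.to_nat (1, 0)),
              Cantor.to_nat (i * 2 ^ m, Cantor.to_nat (2 * S N, pred (S N * 2 ^ m))))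
       else Cantor.to_nat (Cantor.to_nat (i * 2 ^ m + 2 * S N, Cantor.to_nat (0, pred (S N * 2 ^ m))),
              Cantor.to_nat (2, Cantor.to_nat (0, 0))))
  else 0.

(** Once something is seen, the output is a grid point located to precision [2^-n]. Before that, the
    answer is read one digit ahead, to leave room for the distance between the oracle's point and
    the singleton. *)
Definition H_output (p r : name) (n N : nat) : nat :=
  if seen p n then Cantor.to_nat (location p n N, Cantor.to_nat (0, N)) else r (S n).

Lemma K_code : exists e, forall p n N,
  search_done p (S (S (first_seen p n))) n N = true ->
  (forall M, M < N -> search_done p (S (S (first_seen p n))) n M = false) ->
  eval p e [n] (K_output p n N).
Proof.
  assert (Ho : computable_access (fun p => p)) by (intros k f; apply computable_oracle).
  apply (mu_code
    (fun p xs => search_done p (S (S (first_seen p (hd 0 (tl xs))))) (hd 0 (tl xs)) (hd 0 xs))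
    (fun p xs => K_output p (hd 0 (tl xs)) (hd 0 xs))).
  - apply (computable_search_done (fun p => p)); computable_tac.
    + exact Ho.
    + apply (computable_first_seen (fun p => p)); computable_tac. exact Ho.
  - assert (Hs : computable 2 (fun p xs => first_seen p (hd 0 (tl xs)))).
    { apply (computable_first_seen (fun p => p)); computable_tac. exact Ho. }
    assert (Hi : computable 2 (fun p xs =>
      location p (S (S (first_seen p (hd 0 (tl xs))))) (hd 0 xs))).
    { apply (computable_location (fun p => p)); computable_tac; [exact Ho | exact Hs]. }
    unfold K_output. computable_tac; try assumption.
    apply (computable_seen (fun p => p)); computable_tac. exact Ho.
Qed.

Lemma pairing_even (p r : name) : (fun j => pairing p r (2 * j)) = p.
Proof.
  apply functional_extensionality. intros j. unfold pairing.
  rewrite Nat.even_even, Nat.div2_even. reflexivity.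
Qed.

Lemma pairing_odd (p r : name) (j : nat) : pairing p r (2 * j + 1) = r j.
Proof. unfold pairing. rewrite Nat.even_odd, Nat.div2_odd'. reflexivity. Qed.

Lemma H_code : exists e, forall p r n N,
  search_done p n n N = true -> (forall M, M < N -> search_done p n n M = false) ->
  eval (pairing p r) e [n] (H_output p r n N).
Proof.
  set (ora := fun (o : name) (j : nat) => o (2 * j)).
  assert (Ho : computable_access ora).
  { intros k f Hf. apply computable_oracle. now apply computable_mul; [apply computable_const|]. }
  destruct (mu_code
    (fun o xs => search_done (ora o) (hd 0 (tl xs)) (hd 0 (tl xs)) (hd 0 xs))
    (fun o xs => if seen (ora o) (hd 0 (tl xs))
       then Cantor.to_nat (location (ora o) (hd 0 (tl xs)) (hd 0 xs), Cantor.to_nat (0, hd 0 xs))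
       else o (2 * S (hd 0 (tl xs)) + 1))) as [e He].
  - apply computable_search_done; computable_tac. exact Ho.
  - computable_tac.
    + apply computable_seen; computable_tac. exact Ho.
    + apply computable_location; computable_tac. exact Ho.
    + apply computable_oracle. computable_tac.
  - exists e. intros p r n N H1 H2. specialize (He (pairing p r) n N).
    unfold ora in He. cbn [hd tl] in He. rewrite pairing_even, pairing_odd in He. auto.
Qed.

Local Open Scope R_scope.

(** * Grid arithmetic and correctness of the searches *)

Definition grid (N i : nat) : R := INR i / INR (S N).

Lemma INR_S_pos (N : nat) : 0 < INR (S N).
Proof. apply lt_0_INR. lia. Qed.

Lemma fraction_lt (a b c d : R) : 0 < b -> 0 < d -> (a / b < c / d <-> a * d < c * b).
Proof.
  intros Hb Hd. split; intros H.
  - apply Rmult_lt_compat_r with (r := b * d) in H; [|nra].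
    field_simplify in H; lra.
  - apply Rmult_lt_reg_r with (b * d); [nra|]. field_simplify; lra.
Qed.

Lemma nu_ltb_spec (a u N : nat) : nu_ltb a u N = true <-> nu a < grid N u.
Proof.
  unfold nu_ltb, nu, grid. destruct (Cantor.of_nat a) as [x bc]. cbn [fst snd].
  destruct (Cantor.of_nat bc) as [b c]. cbn [fst snd].
  rewrite Nat.ltb_lt, (fraction_lt _ _ _ _ (INR_S_pos c) (INR_S_pos N)).
  split; intros H.
  - apply lt_INR in H. rewrite plus_INR, !mult_INR in H. lra.
  - apply INR_lt. rewrite plus_INR, !mult_INR. lra.
Qed.

Lemma nu_gtb_spec (a u N : nat) : nu_gtb a u N = true <-> grid N u < nu a.
Proof.
  unfold nu_gtb, nu, grid. destruct (Cantor.of_nat a) as [x bc]. cbn [fst snd].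
  destruct (Cantor.of_nat bc) as [b c]. cbn [fst snd].
  rewrite Nat.ltb_lt, (fraction_lt _ _ _ _ (INR_S_pos N) (INR_S_pos c)).
  split; intros H.
  - apply lt_INR in H. rewrite plus_INR, !mult_INR in H. lra.
  - apply INR_lt. rewrite plus_INR, !mult_INR. lra.
Qed.

Lemma grid_S (N i : nat) : grid N (S i) = grid N i + / INR (S N).
Proof. unfold grid. rewrite (S_INR i). field. apply Rgt_not_eq, INR_S_pos. Qed.

Lemma grid_step_pos (N : nat) : 0 < / INR (S N).
Proof. apply Rinv_0_lt_compat, INR_S_pos. Qed.

Lemma grid_le (N i j : nat) : (i <= j)%nat -> grid N i <= grid N j.
Proof.
  intros H. apply Rmult_le_compat_r; [left; apply grid_step_pos | now apply le_INR].
Qed.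

Lemma grid_last (N : nat) : grid N (S N) = 1.
Proof. unfold grid. field. apply Rgt_not_eq, INR_S_pos. Qed.

Lemma grid_first (N : nat) : grid N 0 = 0.
Proof. unfold grid. simpl INR at 1. unfold Rdiv. ring. Qed.

Lemma grid_in01 (N i : nat) : (i <= S N)%nat -> in01 (grid N i).
Proof.
  intros H. split; [rewrite <- (grid_first N) | rewrite <- (grid_last N)]; apply grid_le; lia.
Qed.

Lemma grid_cell (N : nat) (x : R) :
  in01 x -> exists i, (i <= N)%nat /\ grid N i <= x <= grid N (S i).
Proof.
  intros Hx.
  assert (H : forall n, (n <= N)%nat -> x <= grid N (S n) ->
            exists i, (i <= N)%nat /\ grid N i <= x <= grid N (S i)).
  { induction n as [|n IH]; intros Hn Hle.
    - exists 0%nat. rewrite grid_first. unfold in01 in Hx. split; [lia | lra].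
    - destruct (Rle_lt_dec x (grid N (S n))) as [Hl | Hl].
      + apply IH; [lia | exact Hl].
      + exists (S n). split; [lia | lra]. }
  apply (H N (le_n N)). rewrite grid_last. apply Hx.
Qed.

Lemma covered_spec (p : name) (N i : nat) :
  covered p N i = true <->
  exists j, (j < N)%nat /\ removes p j (grid N i) /\ removes p j (grid N (S i)).
Proof.
  unfold covered. rewrite bounded_ex_spec.
  assert (H : forall j,
    (negb (p j =? 0)%nat && (nu_ltb (fst (of_nat (Nat.pred (p j)))) i N &&
       nu_gtb (snd (of_nat (Nat.pred (p j)))) (S i) N))%bool = true <->
    removes p j (grid N i) /\ removes p j (grid N (S i))).
  { intros j. rewrite !Bool.andb_true_iff, nu_ltb_spec, nu_gtb_spec, Bool.negb_true_iff, Nat.eqb_neq.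
    pose proof (grid_le N i (S i) ltac:(lia)) as Hle.
    unfold removes, interval_of. split.
    - intros [Hp [H1 H2]]. destruct (p j) as [|k]; [lia|]. cbn [Nat.pred] in *.
      destruct (Cantor.of_nat k) as [a b] eqn:E. cbn [fst snd] in *.
      split; exists k; rewrite E; split; trivial; lra.
    - intros [[k [Hk H1]] [k' [Hk' H2]]]. rewrite Hk in *. injection Hk' as <-. cbn [Nat.pred].
      destruct (Cantor.of_nat k) as [a b]. cbn [fst snd]. split; [lia | lra]. }
  split; intros [j [Hj Hr]]; exists j; (split; [exact Hj|]); now apply H.
Qed.

Lemma removes_convex (p : name) (j : nat) (x y z : R) :
  removes p j x -> removes p j y -> x <= z <= y -> removes p j z.
Proof.
  intros [k [Hk H1]] [k' [Hk' H2]] Hz. exists k. split; [exact Hk|].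
  rewrite Hk in Hk'. injection Hk' as <-. unfold interval_of in *.
  destruct (Cantor.of_nat k). lra.
Qed.

Lemma not_covered (p : name) (A : R -> Prop) (N i : nat) (z : R) :
  delta_A p A -> A z -> grid N i <= z <= grid N (S i) -> covered p N i = false.
Proof.
  intros Hp Hz Hi. apply Bool.not_true_is_false. intros Hc.
  apply covered_spec in Hc. destruct Hc as [j [_ [H1 H2]]].
  apply (proj2 (delta_A_removes p A z Hp (proj1 Hp z Hz))); [|exact Hz].
  exists j. exact (removes_convex p j _ _ z H1 H2 Hi).
Qed.

Lemma bounded_ex_false (n : nat) (P : nat -> bool) :
  (forall i, (i < n)%nat -> P i = false) -> bounded_ex n P = false.
Proof.
  intros H. apply Bool.not_true_is_false. intros Ht. apply bounded_ex_spec in Ht.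
  destruct Ht as [i [Hi HP]]. rewrite (H i Hi) in HP. discriminate.
Qed.

(** There is no false alarm: a covered cell would have its endpoints removed from the set. *)
Lemma seen_full (p : name) (n : nat) : delta_A p in01 -> seen p n = false.
Proof.
  intros Hp. apply bounded_ex_false. intros s _. apply bounded_ex_false. intros i Hi.
  apply not_covered with in01 (grid s i); [exact Hp | apply grid_in01; lia |].
  split; [lra | apply grid_le; lia].
Qed.

Lemma located_spec (p : name) (m N i : nat) :
  located p m N i = true <-> forall j, (j <= N)%nat ->
    covered p N j = true \/ Rabs (grid N j - grid N i) + / INR (S N) <= / 2 ^ m.
Proof.
  assert (Hpow : 0 < 2 ^ m) by (apply pow_lt; lra).
  pose proof (INR_S_pos N) as HN.
  assert (H : forall j, (S ((j - i) + (i - j)) * 2 ^ m <=? S N)%nat = true <->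
              Rabs (grid N j - grid N i) + / INR (S N) <= / 2 ^ m).
  { intros j. rewrite Nat.leb_le.
    (* With truncated subtraction [(j - i) + (i - j)] is the distance of [i] and [j]; the successor
       accounts for the width of cell [j]. *)
    assert (Habs : Rabs (grid N j - grid N i) + / INR (S N) =
                   INR (S ((j - i) + (i - j))) / INR (S N)).
    { assert (Hd : INR (S ((j - i) + (i - j))) = Rabs (INR j - INR i) + 1).
      { rewrite S_INR. f_equal. destruct (Nat.le_gt_cases i j) as [Hij | Hij].
        - replace (i - j)%nat with 0%nat by lia. rewrite Nat.add_0_r, minus_INR by exact Hij.
          apply le_INR in Hij. rewrite Rabs_pos_eq; lra.
        - replace (j - i)%nat with 0%nat by lia. rewrite Nat.add_0_l, minus_INR by lia.
          apply lt_INR in Hij. rewrite Rabs_left; lra. }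
      rewrite Hd. unfold grid. replace (INR j / INR (S N) - INR i / INR (S N))
        with ((INR j - INR i) * / INR (S N)) by (field; lra).
      rewrite Rabs_mult, (Rabs_pos_eq (/ INR (S N))) by (left; apply grid_step_pos).
      field. lra. }
    rewrite Habs. set (D := S ((j - i) + (i - j))).
    assert (HD : (D * 2 ^ m <= S N)%nat <-> INR D * 2 ^ m <= INR (S N)).
    { assert (E : INR (D * 2 ^ m) = INR D * 2 ^ m)
        by (rewrite mult_INR, pow_INR; reflexivity).
      rewrite <- E. split; [apply le_INR | apply INR_le]. }
    rewrite HD. split; intros Hle.
    - apply Rmult_le_reg_r with (INR (S N) * 2 ^ m); [nra|].
      replace (INR D / INR (S N) * (INR (S N) * 2 ^ m)) with (INR D * 2 ^ m) by (field; lra).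
      replace (/ 2 ^ m * (INR (S N) * 2 ^ m)) with (INR (S N)) by (field; lra). exact Hle.
    - apply Rmult_le_compat_r with (r := INR (S N) * 2 ^ m) in Hle; [|nra].
      replace (INR D / INR (S N) * (INR (S N) * 2 ^ m)) with (INR D * 2 ^ m) in Hle by (field; lra).
      replace (/ 2 ^ m * (INR (S N) * 2 ^ m)) with (INR (S N)) in Hle by (field; lra). exact Hle. }
  unfold located. rewrite Bool.negb_true_iff. split.
  - intros Hex j Hj.
    destruct (covered p N j || (S ((j - i) + (i - j)) * 2 ^ m <=? S N)%nat)%bool eqn:E.
    + apply Bool.orb_true_iff in E. destruct E as [E | E]; [now left | right; now apply H].
    + exfalso. rewrite (proj2 (bounded_ex_spec _ _)) in Hex; [discriminate|].
      exists j. split; [lia|]. now rewrite E.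
  - intros Hall. apply bounded_ex_false. intros j Hj. apply Bool.negb_false_iff, Bool.orb_true_iff.
    destruct (Hall j) as [Hc | Hc]; [lia | now left | right; now apply H].
Qed.

(** The cell containing [x] is never covered, hence it is one of the cells close to the located grid
    point. *)
Lemma located_near (p : name) (A : R -> Prop) (m N i : nat) (x : R) :
  delta_A p A -> A x -> located p m N i = true -> Rabs (grid N i - x) <= / 2 ^ m.
Proof.
  intros Hp Hx Hloc.
  destruct (grid_cell N x (proj1 Hp x Hx)) as [j [Hj Hc]].
  destruct (proj1 (located_spec p m N i) Hloc j Hj) as [Hcov | Hd].
  - rewrite (not_covered p A N j x Hp Hx Hc) in Hcov. discriminate.
  - rewrite grid_S in Hc.
    replace (grid N i - x) with (- (grid N j - grid N i) + (grid N j - x)) by ring.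
    apply Rle_trans with (1 := Rabs_triang _ _). rewrite Rabs_Ropp.
    assert (Rabs (grid N j - x) <= / INR (S N)) by (apply Rabs_le; lra). lra.
Qed.

(** On a grid finer than the Lebesgue number, every cell is covered by one of finitely many
    intervals or starts near [x]; the left end of the cell around [x] then serves as the
    location. *)
Lemma located_exists (p : name) (A : R -> Prop) (x : R) (m : nat) :
  delta_A p A -> in01 x -> (forall z, A z <-> z = x) ->
  exists N i, (i <= N)%nat /\ located p m N i = true.
Proof.
  intros Hp Hx HA. pose proof (inv_pow2_pos m) as Hm.
  destruct (delta_A_singleton_lebesgue p A x (/ 2 ^ m / 2) Hp HA) as [N0 [d [Hd HN0]]]; [lra|].
  (* The budget [2^-m] splits into a half for the ball around [x], a quarter for the offset of [x]
     in its cell and a quarter for the width of cell [j]. *)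
  destruct (inv_INR_S_small (Rmin d (/ 2 ^ m / 4))) as [N1 HN1]; [apply Rmin_pos; lra|].
  set (N := Nat.max N0 N1).
  assert (HN : / INR (S N) < Rmin d (/ 2 ^ m / 4)).
  { apply Rle_lt_trans with (2 := HN1). apply Rinv_le_contravar; [apply INR_S_pos|].
    apply le_INR. lia. }
  pose proof (Rmin_l d (/ 2 ^ m / 4)) as H1. pose proof (Rmin_r d (/ 2 ^ m / 4)) as H2.
  pose proof (grid_step_pos N) as Hs.
  destruct (grid_cell N x Hx) as [i [Hi Hxi]]. rewrite grid_S in Hxi.
  exists N, i. split; [exact Hi|]. apply located_spec. intros j Hj.
  destruct (HN0 (grid N j)) as [Hw | [n [Hn Hw]]]; [apply grid_in01; lia | right | left].
  - assert (Hjx := Hw (grid N j) ltac:(rewrite Rminus_diag, Rabs_R0; exact Hd)).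
    replace (grid N j - grid N i) with ((grid N j - x) + (x - grid N i)) by ring.
    pose proof (Rabs_triang (grid N j - x) (x - grid N i)).
    assert (Rabs (x - grid N i) <= / INR (S N)) by (apply Rabs_le; lra). lra.
  - apply covered_spec. exists n. split; [lia|]. split; apply Hw.
    + rewrite Rminus_diag, Rabs_R0. exact Hd.
    + rewrite grid_S, Rabs_pos_eq; lra.
Qed.

(** At precision [1/4] the first and the last cell cannot both be close to one grid point, as
    together they reach from 0 to 1; so one of them is covered. *)
Lemma detected_exists (p : name) (A : R -> Prop) (x : R) :
  delta_A p A -> in01 x -> (forall z, A z <-> z = x) -> exists s, detected p s = true.
Proof.
  intros Hp Hx HA.
  destruct (located_exists p A x 2 Hp Hx HA) as [N [i [Hi Hloc]]].
  exists N. apply bounded_ex_spec. rewrite located_spec in Hloc.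
  pose proof (grid_step_pos N) as Hs.
  destruct (Hloc 0%nat) as [H0 | H0]; [lia | exists 0%nat; split; [lia | exact H0] |].
  destruct (Hloc N) as [H1 | H1]; [lia | exists N; split; [lia | exact H1] |].
  exfalso. rewrite grid_first in H0.
  pose proof (grid_last N) as HN. rewrite grid_S in HN.
  assert (/ 2 ^ 2 = / 4) as E by (f_equal; ring). rewrite E in *.
  assert (G0 := Rle_abs (- (0 - grid N i))). rewrite Rabs_Ropp in G0.
  assert (G1 := Rle_abs (grid N N - grid N i)). lra.
Qed.

(** * Correctness of the forward and backward functionals *)

Lemma least_witness (P : nat -> bool) (n : nat) :
  P n = true -> exists m, P m = true /\ forall k, (k < m)%nat -> P k = false.
Proof.
  intros Hn. destruct (bounded_min_spec (S n) P) as [H1 [_ H3]].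
  exists (bounded_min (S n) P). split; [|exact H1]. apply H3.
  apply Nat.nle_gt. intros Hle. rewrite H1 in Hn; [discriminate | lia].
Qed.

Lemma location_spec (p : name) (m N : nat) :
  bounded_ex (S N) (located p m N) = true -> located p m N (location p m N) = true.
Proof.
  intros H. unfold bounded_ex in H. apply Nat.ltb_lt in H.
  destruct (bounded_min_spec (S N) (located p m N)) as [_ [_ H3]]. exact (H3 H).
Qed.

Lemma first_detected (p : name) (s : nat) :
  detected p s = true -> (forall k, (k < s)%nat -> detected p k = false) ->
  forall n, seen p n = (s <=? n)%nat /\ ((s <= n)%nat -> first_seen p n = s).
Proof.
  intros Hs Hlt n. unfold seen, first_seen.
  destruct (bounded_min_spec (S n) (detected p)) as [H1 [H2 H3]].
  destruct (Nat.leb_spec s n) as [Hn | Hn].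
  - split; [apply bounded_ex_spec; exists s; split; [lia | exact Hs]|]. intros _.
    destruct (Nat.lt_trichotomy (bounded_min (S n) (detected p)) s) as [H | [H | H]]; [|exact H|].
    + rewrite (Hlt _ H) in H3. discriminate H3. lia.
    + rewrite (H1 _ H) in Hs. discriminate.
  - split; [|lia]. apply bounded_ex_false. intros k Hk. apply Hlt. lia.
Qed.

Lemma search_done_unseen (p : name) (m n N : nat) :
  seen p n = false -> search_done p m n N = true.
Proof. intros H. unfold search_done. now rewrite H. Qed.

Lemma search_done_seen (p : name) (m n N : nat) :
  seen p n = true -> search_done p m n N = bounded_ex (S N) (located p m N).
Proof. intros H. unfold search_done. now rewrite H. Qed.

(** These are the cuts of [K_output] over the common denominator [(N+1) * 2^m]; the predecessor
    offsets the successor that [nu] applies to denominators. *)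
Lemma cut_spec (i m N : nat) :
  nu (Cantor.to_nat (i * 2 ^ m, Cantor.to_nat (2 * S N, Nat.pred (S N * 2 ^ m))))%nat
    = grid N i - 2 * / 2 ^ m /\
  nu (Cantor.to_nat (i * 2 ^ m + 2 * S N, Cantor.to_nat (0, Nat.pred (S N * 2 ^ m))))%nat
    = grid N i + 2 * / 2 ^ m.
Proof.
  rewrite !nu_to_nat.
  assert (Hp : (0 < 2 ^ m)%nat) by (apply Nat.neq_0_lt_0, Nat.pow_nonzero; lia).
  replace (S (Nat.pred (S N * 2 ^ m))) with (S N * 2 ^ m)%nat by nia.
  rewrite plus_INR, !mult_INR, pow_INR. replace (INR 2) with 2 by reflexivity.
  replace (INR 0) with 0 by reflexivity. unfold grid.
  assert (0 < 2 ^ m) by (apply pow_lt; lra). pose proof (INR_S_pos N).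
  split; field; lra.
Qed.

(** With [e = 2^-(s+2)] the grid point [q] is within [e] of [x], so [[q-2e, q+2e]] contains [x] in
    its interior and meets [[0,1]] in a nondegenerate segment, whose points are within [3e < 2^-s]
    of [x]. *)
Lemma K_window (p : name) (A : R -> Prop) (x : R) (s N : nat) :
  delta_A p A -> in01 x -> (forall z, A z <-> z = x) ->
  (forall n, seen p n = (s <=? n)%nat /\ ((s <= n)%nat -> first_seen p n = s)) ->
  bounded_ex (S N) (located p (S (S s)) N) = true ->
  exists a b, 0 <= a < b /\ b <= 1 /\ (forall z, segment a b z -> Rabs (z - x) <= / 2 ^ s) /\
    delta_A (fun n => if (n <? s)%nat then 0%nat else K_output p n N) (segment a b).
Proof.
  intros Hp Hx HA Hseen Hex.
  set (m := S (S s)) in *. set (i := location p m N).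
  pose proof (inv_pow2_pos m) as He. set (e := / 2 ^ m) in *.
  assert (Hse : / 2 ^ s = 4 * e) by (unfold e, m; rewrite !inv_pow2_S; lra).
  assert (Hq : Rabs (grid N i - x) <= e).
  { apply located_near with p A; [exact Hp | now apply HA | now apply location_spec]. }
  set (q := grid N i) in *.
  apply Rabs_le_between in Hq. unfold in01 in Hx.
  exists (Rmax 0 (q - 2 * e)), (Rmin 1 (q + 2 * e)).
  assert (Hlo : nu (to_nat (0, to_nat (1, 0)))%nat = -1).
  { rewrite nu_to_nat. simpl. field. }
  assert (Hhi : nu (to_nat (2, to_nat (0, 0)))%nat = 2).
  { rewrite nu_to_nat. simpl. field. }
  destruct (cut_spec i m N) as [Hl Hr]. fold e q in Hl, Hr.
  assert (Hseg : forall z, in01 z ->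
            (segment (Rmax 0 (q - 2 * e)) (Rmin 1 (q + 2 * e)) z <-> q - 2 * e <= z <= q + 2 * e)).
  { intros z Hz. unfold in01, segment, Rmax, Rmin in *.
    destruct (Rle_dec 0 (q - 2 * e)), (Rle_dec 1 (q + 2 * e)); lra. }
  assert (Hin : forall z, segment (Rmax 0 (q - 2 * e)) (Rmin 1 (q + 2 * e)) z -> in01 z).
  { intros z [Hz1 Hz2]. pose proof (Rmax_l 0 (q - 2 * e)). pose proof (Rmin_l 1 (q + 2 * e)).
    unfold in01. lra. }
  split; [|split; [apply Rmin_l | split]].
  { unfold Rmax, Rmin. destruct (Rle_dec 0 (q - 2 * e)), (Rle_dec 1 (q + 2 * e)); lra. }
  { intros z Hz. apply Hseg in Hz as Hz'; [|now apply Hin]. apply Rabs_le. lra. }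
  split; [exact Hin|]. intros z Hz. rewrite (Hseg z Hz).
  assert (Hk : forall n, (s <= n)%nat -> K_output p n N = S (if (n =? s)%nat
     then to_nat (to_nat (0, to_nat (1, 0)), to_nat (i * 2 ^ m, to_nat (2 * S N, Nat.pred (S N * 2 ^ m))))
     else to_nat (to_nat (i * 2 ^ m + 2 * S N, to_nat (0, Nat.pred (S N * 2 ^ m))),
                  to_nat (2, to_nat (0, 0))))%nat).
  { intros n Hn. destruct (Hseen n) as [H1 H2]. unfold K_output.
    rewrite H1, (H2 Hn), (proj2 (Nat.leb_le s n) Hn). reflexivity. }
  split.
  (* The left cut is listed at entry [s] and the right cut from entry [s+1] on; their outer ends
     [-1] and [2] lie outside [[0,1]]. *)
  - intros Hout. destruct (Rlt_le_dec z (q - 2 * e)) as [Hzl | Hzl].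
    + exists s. rewrite Nat.ltb_irrefl, (Hk s (le_n s)), Nat.eqb_refl. eexists.
      split; [reflexivity|]. rewrite interval_of_to_nat, Hl, Hlo. unfold in01 in Hz. lra.
    + exists (S s). rewrite (proj2 (Nat.ltb_ge (S s) s)) by lia.
      rewrite (Hk (S s)) by lia. rewrite (proj2 (Nat.eqb_neq (S s) s)) by lia. eexists.
      split; [reflexivity|]. rewrite interval_of_to_nat, Hr, Hhi. unfold in01 in Hz. lra.
  - intros [n [k [Hkn Hi]]]. destruct (Nat.ltb_spec n s) as [Hn | Hn]; [discriminate|].
    rewrite (Hk n Hn) in Hkn. apply eq_add_S in Hkn. subst k.
    destruct (n =? s)%nat; rewrite interval_of_to_nat in Hi.
    + rewrite Hl in Hi. lra.
    + rewrite Hr in Hi. lra.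
Qed.

Lemma W_le_AUC_PCC : W_le delta_A delta_C AUC01 delta_A delta_C PCC01.
Proof.
  destruct K_code as [eK HK]. destruct H_code as [eH HH].
  exists eH, eK. intros G HG p A Hp [z0 [[Hfull | [x [Hx HA]]] _]].
  - assert (Hp01 : delta_A p in01) by exact (delta_A_ext p A in01 Hfull Hp).
    assert (Hno : forall n, seen p n = false) by (intros n; now apply seen_full).
    destruct (HG (fun _ => 0%nat) in01) as [r [y [HGr [Hy [_ Hyin]]]]].
    { exact delta_A_empty_name. }
    { assert (in01 0) by (unfold in01; lra). exists 0. split; [|assumption].
      exists 0, 1. unfold in01. split; [lra|]. split; [lra|]. tauto. }
    exists (fun _ => 0%nat), r, (fun n => r (S n)), y.
    split; [|split; [exact HGr | split; [|split]]].
    (* Nothing is ever seen, so every search ends at [N = 0]. *)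
    + intros n. replace 0%nat with (K_output p n 0) by (unfold K_output; now rewrite Hno).
      apply HK; [now apply search_done_unseen | intros M HM; lia].
    + intros n. replace (r (S n)) with (H_output p r n 0) by (unfold H_output; now rewrite Hno).
      apply HH; [now apply search_done_unseen | intros M HM; lia].
    + split; [exact Hyin|]. intros n. apply Rle_trans with (1 := proj2 Hy (S n)), inv_pow2_le. lia.
    + split; [now left | now apply Hfull].
  - destruct (detected_exists p A x Hp Hx HA) as [s0 Hs0].
    destruct (least_witness _ _ Hs0) as [s [Hs Hslt]].
    pose proof (first_detected p s Hs Hslt) as Hseen.
    assert (Hsearch : forall m, exists N, bounded_ex (S N) (located p m N) = true /\
              forall M, (M < N)%nat -> bounded_ex (S M) (located p m M) = false).
    { intros m. destruct (located_exists p A x m Hp Hx HA) as [N [i [Hi Hloc]]].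
      apply (least_witness (fun N => bounded_ex (S N) (located p m N)) N).
      apply bounded_ex_spec. exists i. split; [lia | exact Hloc]. }
    destruct (Hsearch (S (S s))) as [N [HN HNlt]].
    destruct (K_window p A x s N Hp Hx HA Hseen HN) as [a [b [Hab [Hb [Hnear Hk]]]]].
    set (k := fun n => if (n <? s)%nat then 0%nat else K_output p n N) in *.
    destruct (HG k (segment a b) Hk) as [r [y [HGr [[_ Hy] [_ Hyab]]]]].
    { exists a. split; [|unfold segment; lra]. exists a, b. unfold segment. tauto. }
    assert (Ho : forall n, exists v, eval (pairing p r) eH [n] v /\ Rabs (nu v - x) <= / 2 ^ n).
    { intros n. destruct (Hseen n) as [H1 H2]. destruct (Nat.leb_spec s n) as [Hn | Hn].
      - destruct (Hsearch n) as [M [HM HMlt]].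
        exists (H_output p r n M). split.
        + apply HH; [now rewrite search_done_seen|].
          intros M' HM'. rewrite search_done_seen by exact H1. auto.
        + unfold H_output. rewrite H1, nu_to_nat. replace (INR 0) with 0 by reflexivity.
          rewrite Rminus_0_r. apply located_near with p A; [exact Hp | now apply HA|].
          now apply location_spec.
      - exists (H_output p r n 0). split.
        + apply HH; [now apply search_done_unseen | intros M HM; lia].
        + unfold H_output. rewrite H1.
          (* Digit [n+1] of the answer errs from [y] by at most [2^-(n+1)], and [y] is within
             [2^-s <= 2^-(n+1)] of [x] because [n < s]. *)
          replace (nu (r (S n)) - x) with ((nu (r (S n)) - y) + (y - x)) by ring.
          apply Rle_trans with (1 := Rabs_triang _ _).
          specialize (Hy (S n)). specialize (Hnear y Hyab).
          pose proof (inv_pow2_le (S n) s Hn). pose proof (inv_pow2_S n). lra. }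
    apply functional_choice in Ho. destruct Ho as [o Ho].
    exists k, r, o, x. split; [|split; [exact HGr | split; [|split]]].
    + intros n. unfold k. destruct (Hseen n) as [H1 H2].
      destruct (Nat.ltb_spec n s) as [Hn | Hn].
      * rewrite (proj2 (Nat.leb_gt s n) Hn) in H1.
        replace 0%nat with (K_output p n 0) by (unfold K_output; now rewrite H1).
        apply HK; [now apply search_done_unseen | intros M HM; lia].
      * rewrite (proj2 (Nat.leb_le s n) Hn) in H1.
        (* From stage [s] on [first_seen] is constantly [s], so every entry searches at the same
           precision and ends at the same [N]. *)
        apply HK; rewrite (H2 Hn).
        -- now rewrite search_done_seen.
        -- intros M HM. rewrite search_done_seen by exact H1. auto.
    + intros n. apply Ho.
    + split; [exact Hx|]. intros n. apply Ho.
    + split; [right; now exists x | now apply HA].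
Qed.

Theorem theorem16p2 : W_lt delta_A delta_C AUC01 delta_A delta_C PCC01.
Proof. split; [exact W_le_AUC_PCC | exact not_W_le_PCC_AUC]. Qed.
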